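(* Let $g\in H^\infty$ have no zero on $\mathbb D$, and let $\psi$ be an analytic map of $\mathbb D$ into itself. Assume that $W_{f,\varphi}$ is self-adjoint on $F^2$, where $f\in H^\infty$ and $\varphi$ is an analytic map of $\mathbb D$ into itself, that $W_{g,\psi}\in\{W_{f,\varphi}\}'$, that $\varphi$ is not the identity map, is not an elliptic automorphism of $\mathbb D$, and has a fixed point $b\in\mathbb D$, and that $C_\psi$ is bounded on $F^2$. Then $W_{g,\psi}$ is normal on $F^2$.
   Context: $\mathbb D$ is the open unit disk in $\mathbb C$ and $H^\infty$ denotes the bounded analytic functions on $\mathbb D$. The Fock space $F^2$ is the Hilbert space of entire functions $h$ with $\frac1\pi\int_{\mathbb C}|h(z)|^2e^{-|z|^2}\,dA(z)<\infty$ ($dA$ is Euclidean area measure), with inner product $\langle h,k\rangle=\frac1\pi\int_{\mathbb C}h(z)\overline{k(z)}e^{-|z|^2}\,dA(z)$; its reproducing kernel is $K_\beta(z)=e^{\overline\beta z}$. For an analytic map $\varphi:\mathbb C\to\mathbb C$, the composition operator is $C_\varphi h=h\circ\varphi$; for an entire function $f$ the weighted composition operator is $(W_{f,\varphi}h)(z)=f(z)h(\varphi(z))$, $h\in F^2$. Symbols of operators on $F^2$ are understood to be entire functions; conditions such as $f\in H^\infty$ or ''$\varphi$ is an analytic map of $\mathbb D$ into itself'' refer to their restrictions to $\mathbb D$. Self-adjoint means bounded and self-adjoint. For a bounded operator $T$ on $F^2$, $\{T\}'$ is the set of all bounded operators $S$ on $F^2$ with $TS=ST$. An elliptic automorphism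 of $\mathbb D$ is an analytic automorphism of $\mathbb D$, other than the identity, having a fixed point in $\mathbb D$.
   Formalization: The formal theorem additionally assumes that f is not identically zero; for f = 0 the claim fails, e.g. with φ(z) = z/2, b = 0, g = 1, ψ(z) = z/2 + 1/4, where C_ψ is bounded but not normal. *)

(* Defs.v *)
From HB Require Import structures.
From mathcomp Require Import all_boot all_order all_algebra.
From mathcomp Require Import complex.
From mathcomp Require Import all_classical all_reals all_analysis.

Set Implicit Arguments.
Unset Strict Implicit.
Unset Printing Implicit Defensive.

Import Order.TTheory GRing.Theory Num.Theory.
Import numFieldNormedType.Exports.

Local Open Scope classical_set_scope.
Local Open Scope ring_scope.
Local Open Scope complex_scope.

Section AnalyticFunctions.
Context {R : realType}.
Local Notation C := R[i].
Implicit Types (D : set C) (h : C -> C).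

Definition disk : set C := [set z | `|z| < 1].

(* [derivable] is taken over the scalar field C, in the direction 1: it is
   complex differentiability. *)
Definition analytic_on D h : Prop :=
  forall z, D z -> derivable (h : C^o -> C^o) z 1.

Definition entire h : Prop := analytic_on setT h.

Definition Hinfty h : Prop :=
  analytic_on disk h /\ exists M : C, forall z, disk z -> `|h z| <= M.

Definition analytic_self_map h : Prop :=
  analytic_on disk h /\ forall z, disk z -> disk (h z).

Definition identity_on_disk h : Prop := forall z, disk z -> h z = z.

Definition disk_automorphism h : Prop :=
  analytic_self_map h /\
  exists k : C -> C, [/\ analytic_self_map k,
    forall z, disk z -> k (h z) = z & forall z, disk z -> h (k z) = z].

Definition elliptic_automorphism h : Prop :=
  [/\ disk_automorphism h, ~ identity_on_disk h &
      exists z, disk z /\ h z = z].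

End AnalyticFunctions.

Section FockSpace.
Context {R : realType}.
Local Notation C := R[i].
Implicit Types (h k : C -> C) (T S : (C -> C) -> (C -> C)).

(* C is identified with R * R through (x, y) |-> x +i* y. *)
Definition area : set (measurableTypeR R * measurableTypeR R) -> \bar R :=
  (@lebesgue_measure R \x @lebesgue_measure R)%E.

Definition gauss (z : C) : R := expR (- complex.Re (`|z| ^+ 2)).

Definition fock h : Prop :=
  entire h /\
  ((pi^-1)%:E * \int[area]_p
     (complex.Re (`|h (p.1 +i* p.2)| ^+ 2) * gauss (p.1 +i* p.2))%:E < +oo)%E.

Definition area_integral (F : C -> C) : C :=
  Rintegral area setT (fun p => complex.Re (F (p.1 +i* p.2))) +i*
  Rintegral area setT (fun p => complex.Im (F (p.1 +i* p.2))).

Definition fock_inner h k : C :=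
  (pi^-1)%:C * area_integral (fun z => h z * (k z)^*%C * (gauss z)%:C).

Definition fock_norm h : R := Num.sqrt (complex.Re (fock_inner h h)).

(* An operator on the Fock space is represented by a map on all functions
   C -> C; only its values on [fock] are ever constrained, and operators are
   compared on [fock] only. *)
Definition bounded_operator T : Prop :=
  [/\ forall h, fock h -> fock (T h),
      forall (a : C) h k, fock h -> fock k ->
        T (fun z => a * h z + k z) =1 (fun z => a * T h z + T k z) &
      exists M : R, forall h, fock h -> fock_norm (T h) <= M * fock_norm h].

Definition commute_on_fock T S : Prop :=
  forall h, fock h -> T (S h) =1 S (T h).

Definition commutant T S : Prop := bounded_operator S /\ commute_on_fock T S.

Definition adjoint_of T S : Prop :=
  forall h k, fock h -> fock k -> fock_inner (T h) k = fock_inner h (S k).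

Definition self_adjoint T : Prop := bounded_operator T /\ adjoint_of T T.

Definition normal_operator T : Prop :=
  bounded_operator T /\
  exists S, [/\ bounded_operator S, adjoint_of T S & commute_on_fock T S].

Definition composition_op (phi : C -> C) : (C -> C) -> (C -> C) :=
  fun h z => h (phi z).

Definition weighted_composition_op (f phi : C -> C) : (C -> C) -> (C -> C) :=
  fun h z => f z * h (phi z).

End FockSpace.

(* Main.v *)
Require Import Defs.
From HB Require Import structures.
From mathcomp Require Import all_boot all_order all_algebra.
From mathcomp Require Import complex ring lra.
From mathcomp Require Import all_classical all_reals all_analysis.
From mathcomp Require Import measurable_realfun.

Set Implicit Arguments.
Unset Strict Implicit.
Unset Printing Implicit Defensive.

Import Order.TTheory GRing.Theory Num.Theory.
Import numFieldNormedType.Exports.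

Local Open Scope classical_set_scope.
Local Open Scope ring_scope.
Local Open Scope complex_scope.

(** The idea is that both operators are, up to constants, dilations about the
fixed point b, seen through the unitary Weyl translation that moves b to the
origin, and that such operators are normal.

Self-adjointness of W_(f, phi), tested on the kernels K_w(z) = exp(conj w z),
forces f(z) = f(0) exp(conj(phi(0)) z) and phi(z) = phi(0) + a z with a real
([selfadjoint_symbols]). As phi maps the disk into itself and is neither the
identity nor an elliptic automorphism, |a| < 1 ([real_slope_lt1]), so b is the
only fixed point of phi and phi contracts the plane to b.

Boundedness of C_psi makes psi affine ([bounded_composition_affine]). As the two
operators commute, psi(b) is a fixed point of phi; hence psi(z) = b + d (z - b).
The commutation relation for the weights says that
g(z) exp(- conj b (1 - d) z) is invariant under the contraction phi, hence
constant ([commuting_symbols]). With these symbols W_(g, psi) is g(b) times the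
dilation by d about b, conjugated by the Weyl operator of b
([weighted_composition_weyl_dilation]). Its adjoint has the conjugate
parameters and commutes with it ([weyl_dilation_normal]).

The analytic input is the reproducing property ([reproducing]) and the formula
<h(d z), k> = <h, k(conj d z)> ([dilation_adjoint]). Both come from one
principle: averaging over rotations, the Fock inner product depends only on the
means of h conj k over the circles about 0 ([inner_eq_of_circle_means]), and
such means are controlled by Cauchy's theorem for periodic functions in
logarithmic coordinates ([periodic_vertical_int]). As entire functions are only
assumed to be complex differentiable at each point, Cauchy's theorem is proved
by Goursat's bisection ([goursat_rectangle]). *)

(** * Real-valued modulus, complex differentiability and the exponential *)
Section ComplexPlane.
Context {R : realType}.
Local Notation C := R[i].
Implicit Types (z w t l : C) (h k : C -> C).

(** The norm of [R[i]] takes its values in [R[i]]; all estimates below are made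
    in [R]. *)
Definition cmod z : R := Normc.normc z.
Arguments cmod : simpl never.

Lemma cmodE z : cmod z = Num.sqrt (complex.Re z ^+ 2 + complex.Im z ^+ 2).
Proof. by case: z. Qed.

Lemma normC_cmod z : `|z| = (cmod z)%:C.
Proof. by rewrite normc_def cmodE. Qed.

Lemma cmod_ge0 z : 0 <= cmod z. Proof. by rewrite cmodE sqrtr_ge0. Qed.

Lemma cmod_sqr z : cmod z ^+ 2 = complex.Re z ^+ 2 + complex.Im z ^+ 2.
Proof. by rewrite cmodE sqr_sqrtr// addr_ge0 ?sqr_ge0. Qed.

Lemma cmodM z w : cmod (z * w) = cmod z * cmod w. Proof. exact: Normc.normcM. Qed.

Lemma cmodD z w : cmod (z + w) <= cmod z + cmod w.
Proof. exact: (@le_normcD R z w). Qed.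

Lemma cmodN z : cmod (- z) = cmod z. Proof. exact: (@normcN R z). Qed.

Lemma cmodB z w : cmod (z - w) <= cmod z + cmod w.
Proof. by rewrite -[cmod w]cmodN cmodD. Qed.

Lemma cmod0 : cmod 0 = 0. Proof. exact: Normc.normc0. Qed.

Lemma cmod1 : cmod 1 = 1. Proof. exact: Normc.normc1. Qed.

Lemma cmod_eq0 z : cmod z = 0 -> z = 0. Proof. exact: Normc.eq0_normc. Qed.

Lemma cmod_gt0 z : z != 0 -> 0 < cmod z.
Proof.
move=> z0; rewrite lt_def cmod_ge0 andbT; apply: contraNneq z0 => /cmod_eq0 ->.
by [].
Qed.

Lemma cmodV z : cmod z^-1 = (cmod z)^-1. Proof. exact: Normc.normcV. Qed.

Lemma cmodR (x : R) : cmod x%:C = `|x|.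
Proof. by rewrite cmodE /= expr0n addr0 sqrtr_sqr. Qed.

Lemma cmodJ z : cmod z^*%C = cmod z.
Proof. by rewrite !cmodE; case: z => a b /=; rewrite sqrrN. Qed.

Lemma conjCM z w : (z * w)^*%C = z^*%C * w^*%C. Proof. exact: rmorphM. Qed.

Lemma conjCD z w : (z + w)^*%C = z^*%C + w^*%C. Proof. exact: rmorphD. Qed.

Lemma cmod_Re z : `|complex.Re z| <= cmod z.
Proof. by have := normc_ge_Re z; rewrite normC_cmod lecR. Qed.

Lemma cmod_Im z : `|complex.Im z| <= cmod z.
Proof.
rewrite cmodE -sqrtr_sqr ler_sqrt ?addr_ge0 ?sqr_ge0//.
by rewrite lerDr sqr_ge0.
Qed.

Lemma cmod_le_ReIm z : cmod z <= `|complex.Re z| + `|complex.Im z|.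
Proof.
have [a0 b0] := (normr_ge0 (complex.Re z), normr_ge0 (complex.Im z)).
rewrite -(@ler_pXn2r _ 2)// ?nnegrE ?cmod_ge0 ?addr_ge0// cmod_sqr.
by rewrite -(real_normK (num_real (complex.Re z))) -(real_normK (num_real (complex.Im z))); nra.
Qed.

Lemma diskE z : disk z <-> cmod z < 1.
Proof. by rewrite /disk /= normC_cmod -ltcR. Qed.

(** An epsilon-delta form of the complex derivative, equivalent to [derivable];
    it survives complex conjugation and splits readily into real and imaginary
    parts. *)
Definition cderiv h z l : Prop := forall e : R, 0 < e ->
  exists2 d : R, 0 < d & forall t, cmod t < d ->
    cmod (h (z + t) - h z - l * t) <= e * cmod t.

Lemma derivable_cderiv h z :
  derivable (h : C^o -> C^o) z 1 <-> exists l, cderiv h z l.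
Proof.
split=> [/cvg_ex[l hl]|[l hl]].
  exists l => e e0.
  have /cvgrPdist_le/(_ e%:C) := hl.
  rewrite ltcR => /(_ e0) [d /= d0 dP].
  have d0' : 0 < complex.Re d by move: d0; case: d {dP} => a b; rewrite ltcE/= => /andP[].
  have dE : d = (complex.Re d)%:C.
    by move: d0; case: d {dP d0'} => a b; rewrite ltcE/= => /andP[/eqP -> _].
  exists (complex.Re d) => // t td.
  have [->|t0] := eqVneq t 0.
    by rewrite addr0 subrr mulr0 subr0 cmod0 mulr0.
  have := dP t; rewrite /= sub0r normrN normC_cmod {1}dE ltcR => /(_ td t0).
  rewrite normC_cmod lecR => ht.
  rewrite -ler_pdivrMr ?cmod_gt0// -cmodV -cmodM -cmodN.
  congr (_ <= _): ht; congr cmod.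
  by rewrite /GRing.scale /= mulr1 [t + z]addrC; field.
apply/cvg_ex; exists l; apply/cvgrPdist_le => e.
case: e => e e'; rewrite ltcE/= => /andP[/eqP -> e0].
have [d d0 dP] := hl e e0.
exists d%:C; rewrite /= ?ltcR// => t; rewrite /= sub0r normrN normC_cmod ltcR => td t0.
rewrite normC_cmod lecR.
have := dP t td; rewrite -ler_pdivrMr ?cmod_gt0// -cmodV -cmodM -cmodN => ht.
congr (_ <= _): ht; congr cmod.
by rewrite /GRing.scale /= mulr1 [t + z]addrC; field.
Qed.

Lemma entire_cderiv h z : entire h -> exists l, cderiv h z l.
Proof. by move=> hh; apply/derivable_cderiv; exact: hh. Qed.

Lemma cderiv_entire h : (forall z, exists l, cderiv h z l) -> entire h.
Proof. by move=> hh z _; apply/derivable_cderiv. Qed.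

Lemma entireD h k : entire h -> entire k -> entire (fun z => h z + k z).
Proof. by move=> hh hk z zD; apply: derivableD; [exact: hh|exact: hk]. Qed.

Lemma entireM h k : entire h -> entire k -> entire (fun z => h z * k z).
Proof. by move=> hh hk z zD; apply: derivableM; [exact: hh|exact: hk]. Qed.

Lemma entire_cst l : entire (fun=> l).
Proof. by move=> z _; exact: derivable_cst. Qed.

Lemma entire_id : entire (fun z => z).
Proof. by move=> z _; exact: derivable_id. Qed.

Lemma entireZ l h : entire h -> entire (fun z => l * h z).
Proof. exact/entireM/entire_cst. Qed.

Lemma cderiv_cont h z l : cderiv h z l -> forall e, 0 < e ->
  exists2 d : R, 0 < d & forall t, cmod t < d -> cmod (h (z + t) - h z) < e.
Proof.
move=> hl e e0; have [d d0 dP] := hl 1 ltr01.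
have m0 : 0 < cmod l + 2 by have := cmod_ge0 l; lra.
exists (Num.min d (e / (cmod l + 2))); first by rewrite lt_min d0 divr_gt0.
move=> t; rewrite lt_min => /andP[/dP td]; rewrite ltr_pdivlMr// => te.
have -> : h (z + t) - h z = (h (z + t) - h z - l * t) + l * t by ring.
apply: (le_lt_trans (cmodD _ _)); rewrite cmodM.
have := cmod_ge0 t; rewrite le_eqVlt => /predU1P[t0|t0].
  by move: td; rewrite -t0; lra.
by apply: (le_lt_trans _ te); nra.
Qed.

Lemma cderiv_comp h k z l m :
  cderiv k z l -> cderiv h (k z) m -> cderiv (fun z => h (k z)) z (m * l).
Proof.
move=> kl hm e e0.
have L0 := cmod_ge0 l; have M0 := cmod_ge0 m.
set e1 := e / (2 * (cmod l + 1)).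
have e10 : 0 < e1 by rewrite divr_gt0//; lra.
set e2 := Num.min 1 (e / (2 * (cmod m + 1))).
have e20 : 0 < e2 by rewrite lt_min ltr01 divr_gt0//; lra.
have [d1 d10 h1] := hm e1 e10.
have [d2 d20 h2] := kl e2 e20.
have [d3 d30 h3] := cderiv_cont kl d10.
exists (Num.min d2 d3); first by rewrite lt_min d20.
move=> t; rewrite lt_min => /andP[/h2 t2 /h3 t3].
have := h1 _ t3; rewrite [k z + _]addrC subrK => t1.
have T0 := cmod_ge0 t.
have b1 : cmod (k (z + t) - k z) <= (cmod l + 1) * cmod t.
  have -> : k (z + t) - k z = (k (z + t) - k z - l * t) + l * t by ring.
  apply: (le_trans (cmodD _ _)); rewrite cmodM.
  have : e2 <= 1 by rewrite ge_min lexx.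
  by nra.
have -> : h (k (z + t)) - h (k z) - m * l * t =
  (h (k (z + t)) - h (k z) - m * (k (z + t) - k z)) +
  m * (k (z + t) - k z - l * t) by ring.
apply: (le_trans (cmodD _ _)); rewrite cmodM.
have e1E : e1 * (cmod l + 1) = e / 2.
  by rewrite /e1; field; apply/lt0r_neq0; lra.
have e2E : e2 * (cmod m + 1) <= e / 2.
  have -> : e / 2 = e / (2 * (cmod m + 1)) * (cmod m + 1).
    by field; apply/lt0r_neq0; lra.
  by rewrite ler_pM2r ?ltr_wpDl// ge_min lexx orbT.
have b2 : cmod m * cmod (k (z + t) - k z - l * t) <= (cmod m + 1) * (e2 * cmod t).
  by apply: ler_pM => //; rewrite ?cmod_ge0//; lra.
have b3 := ler_wpM2l (ltW e10) b1.
by nra.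
Qed.

Lemma entire_comp h k : entire h -> entire k -> entire (fun z => h (k z)).
Proof.
move=> hh hk; apply: cderiv_entire => z.
have [l kl] := entire_cderiv z hk; have [m hm] := entire_cderiv (k z) hh.
by exists (m * l); exact: cderiv_comp.
Qed.

(** Conjugating both the argument and the value keeps a function analytic. This
    is how antilinear factors enter contour integrals. *)
Lemma entire_reflect h : entire h -> entire (fun z => (h z^*%C)^*%C).
Proof.
move=> hh; apply: cderiv_entire => z.
have [l hl] := entire_cderiv z^*%C hh; exists l^*%C => e e0.
have [d d0 dP] := hl e e0; exists d => // t; rewrite -cmodJ => /dP.
rewrite [cmod t^*%C]cmodJ -cmodJ; congr (cmod _ <= _).
by rewrite !rmorphB/= rmorphM/= conjcK rmorphD.
Qed.

Definition cexp z : C :=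
  (expR (complex.Re z) * cos (complex.Im z)) +i*
  (expR (complex.Re z) * sin (complex.Im z)).

Lemma cexpD z w : cexp (z + w) = cexp z * cexp w.
Proof.
case: z w => [a b] [c d]; rewrite /cexp /= expRD cosD sinD.
by apply/eqP; rewrite eq_complex /=; apply/andP; split; apply/eqP; ring.
Qed.

Lemma cexp0 : cexp 0 = 1.
Proof. by rewrite /cexp /= expR0 cos0 sin0 mul1r mulr0. Qed.

Lemma cexp_neq0 z : cexp z != 0.
Proof.
apply/eqP => z0; have := cexpD z (- z).
by rewrite subrr cexp0 z0 mul0r => /eqP; rewrite oner_eq0.
Qed.

Lemma cexpN z : cexp (- z) = (cexp z)^-1.
Proof.
apply: (mulfI (cexp_neq0 z)); rewrite -cexpD subrr cexp0 mulfV//.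
exact: cexp_neq0.
Qed.

Lemma cexpB z w : cexp (z - w) = cexp z / cexp w.
Proof. by rewrite cexpD cexpN. Qed.

Lemma cexpR (x : R) : cexp x%:C = (expR x)%:C.
Proof. by rewrite /cexp /= cos0 sin0 mulr1 mulr0. Qed.

Lemma cexpJ z : (cexp z)^*%C = cexp z^*%C.
Proof. by case: z => a b; rewrite /cexp /= cosN sinN mulrN. Qed.

Lemma cmod_cexp z : cmod (cexp z) = expR (complex.Re z).
Proof.
rewrite cmodE /= !exprMn -mulrDr cos2Dsin2 mulr1 sqrtr_sqr.
by rewrite ger0_norm ?expR_ge0.
Qed.

Lemma is_derive_eps (f : R -> R) (x m : R) : is_derive x 1 f m ->
  forall e : R, 0 < e -> exists2 d : R, 0 < d & forall t : R, `|t| < d ->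
   `|f (x + t) - f x - m * t| <= e * `|t|.
Proof.
move=> [hf hl] e e0.
have /cvgrPdist_le/(_ e e0) : h^-1 *: ((f \o shift x) (h *: (1 : R^o)) - f x) @[h --> (0:R^o)^'] --> m.
  by rewrite -hl; exact: hf.
move=> [d /= d0 dP]; exists d => // t td.
have [->|t0] := eqVneq t 0; first by rewrite addr0 mulr0 !subrr !normr0 mulr0.
have := dP t; rewrite /= sub0r normrN => /(_ td t0).
rewrite -(@ler_pM2r _ `|t|) ?normr_gt0// -normrM => ht.
apply: le_trans ht; rewrite le_eqVlt; apply/orP; left; apply/eqP.
rewrite -normrN; congr (`| _ |).
by rewrite /GRing.scale /= mulr1 [t + x]addrC; field.
Qed.

(** The addition formula reduces the claim to the origin, where it follows from
    the derivatives of the real exponential, cosine and sine at 0. *)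
Lemma cderiv_cexp z : cderiv cexp z (cexp z).
Proof.
have h0 : cderiv cexp 0 1.
  move=> e e0.
  have [a [a0 a1 a2]] : exists a : R, [/\ 0 < a, a <= 1 & a * 9 <= e].
    exists (Num.min 1 (e / 9)); split; first by rewrite lt_min ltr01 divr_gt0.
      by rewrite ge_min lexx.
    by rewrite -ler_pdivlMr// ge_min lexx orbT.
  have [d1 d10 h1] := is_derive_eps (is_derive_expR (0:R)) a0.
  have [d2 d20 h2] := is_derive_eps (is_derive_cos (0:R)) a0.
  have [d3 d30 h3] := is_derive_eps (is_derive_sin (0:R)) a0.
  exists (Num.min (Num.min d1 d2) (Num.min d3 a)).
    by rewrite !lt_min d10 d20 d30 a0.
  move=> t; rewrite !lt_min => /andP[/andP[t1 t2] /andP[t3 ta]].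
  have R1 := cmod_Re t; have I1 := cmod_Im t.
  have {h1} := h1 _ (le_lt_trans R1 t1).
  have {h2} := h2 _ (le_lt_trans I1 t2).
  have {h3} := h3 _ (le_lt_trans I1 t3).
  rewrite !add0r expR0 cos0 sin0 !mul1r !oppr0 mul0r ?subr0 ?addr0.
  move=> hs hc he.
  apply: (le_trans (cmod_le_ReIm _)).
  rewrite /cexp cos0 sin0 /= expR0.
  case: t t1 t2 t3 ta R1 I1 hs hc he => x y /= t1 t2 t3 ta R1 I1 hs hc he.
  set m := cmod _ in t1 t2 t3 ta R1 I1 *.
  rewrite ?add0r.
  move: (expR x) (cos y) (sin y) hs hc he => E c s hs hc he.
  have m0 : 0 <= m := cmod_ge0 _.
  set X := E - 1 - x in he; set Y := c - 1 in hc; set Z := s - y in hs.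
  have -> : E * c - 1 * 1 - x = X + (1 + x + X) * Y.
    by rewrite /X /Y; ring.
  have -> : E * s - 1 * 0 - y = Z + (x + X) * (y + Z).
    by rewrite /X /Z; ring.
  have bX : `|X| <= a * m by apply: (le_trans he); rewrite ler_wpM2l// ltW.
  have bY : `|Y| <= a * m by apply: (le_trans hc); rewrite ler_wpM2l// ltW.
  have bZ : `|Z| <= a * m by apply: (le_trans hs); rewrite ler_wpM2l// ltW.
  have m1 : m <= 1 by apply: (le_trans (ltW ta)).
  have am : a * m <= m by rewrite ler_piMl.
  have b1 : `|(1 + x + X) * Y| <= 3 * (a * m).
    rewrite normrM ler_pM//.
    apply: (le_trans (ler_normD _ _)); apply: (@le_trans _ _ (2 + 1)); last by lra.
    apply: lerD; last by lra.
    by apply: (le_trans (ler_normD _ _)); rewrite normr1; lra.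
  have b2 : `|(x + X) * (y + Z)| <= (2 * a) * (2 * m).
    by rewrite normrM ler_pM//; apply: (le_trans (ler_normD _ _)); lra.
  have b3 := ler_normD X ((1 + x + X) * Y).
  have b5 := ler_wpM2r m0 a2.
  have b4 := ler_normD Z ((x + X) * (y + Z)).
  by nra.
move=> e e0.
have c0 : 0 < cmod (cexp z) by rewrite cmod_gt0// cexp_neq0.
have [d d0 dP] := h0 _ (divr_gt0 e0 c0).
exists d => // t /dP; rewrite add0r cexp0 mul1r cexpD => ht.
have -> : cexp z * cexp t - cexp z - cexp z * t = cexp z * (cexp t - 1 - t) by ring.
by rewrite cmodM -ler_pdivlMl// mulrA [_^-1 * _]mulrC.
Qed.

Lemma entire_cexp : entire cexp.
Proof. by apply: cderiv_entire => z; exists (cexp z); exact: cderiv_cexp. Qed.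

End ComplexPlane.
Arguments cmod {R} z : simpl never.
Arguments cexp {R} z : simpl never.

(** * Goursat's lemma on rectangles, in real form *)
Section Goursat.
Context {R : realType}.
Implicit Types (f : R -> R) (u v : R -> R -> R) (a b c e x y : R).

Definition segint f a b : R := \int[lebesgue_measure]_(x in `[a, b]) f x.

Lemma continuous_integrable_itv f a b : continuous f ->
  lebesgue_measure.-integrable `[a, b] (EFin \o f).
Proof.
move=> cf; apply: continuous_compact_integrable; first exact: segment_compact.
exact: continuous_subspaceT.
Qed.

Lemma segintB f g a b : continuous f -> continuous g ->
  segint (fun x => f x - g x) a b = segint f a b - segint g a b.
Proof.
by move=> cf cg; rewrite /segint RintegralB//; exact: continuous_integrable_itv.
Qed.

Lemma segint_split f a b c : continuous f -> a <= b -> b <= c ->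
  segint f a c = segint f a b + segint f b c.
Proof.
move=> cf ab bc; rewrite /segint.
have h := @Rintegral_itvB R f (BLeft a) (BRight c) b (continuous_integrable_itv a c cf).
have -> : \int[lebesgue_measure]_(x in `[b, c]) f x =
  \int[lebesgue_measure]_(x in `]b, c]) f x.
  rewrite Rintegral_itv_obnd_cbnd//.
  apply: integrableS (continuous_integrable_itv b c cf) => //.
  exact: subset_itv_oc_cc.
by rewrite -h ?bnd_simp// addrC subrK.
Qed.

(** A mean value bound: it gives, at once, the integral of a function that is
    nearly constant and the error made. *)
Lemma segint_near f a b c e : continuous f -> a <= b ->
  (forall x, a <= x <= b -> `|f x - c| <= e) ->
  `|segint f a b - c * (b - a)| <= e * (b - a).
Proof.
move=> cf ab fe.
have E d : \int[lebesgue_measure]_(x in `[a, b]) (cst d x) = d * (b - a).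
  have L : fine (lebesgue_measure (`[a, b]%classic : set R)) = b - a.
    rewrite lebesgue_measure_itv/= lte_fin.
    case: ltP => // ba; have -> : b = a by apply/eqP; rewrite eq_le ab ba.
    by rewrite subrr.
  by rewrite -L; exact: Rintegral_cst.
have cc d : continuous (cst d : R -> R) by move=> x; exact: cvg_cst.
have ci d := continuous_integrable_itv a b (cc d).
rewrite -!E /segint -(RintegralB _ (continuous_integrable_itv a b cf) (ci c))//.
apply: le_trans.
  apply: le_normr_Rintegral => //.
  apply: continuous_integrable_itv => x; apply: cvgB; [exact: cf|exact: cvg_cst].
apply: le_Rintegral => //.
  have : continuous (fun x => `|f x - cst c x|).
    by move=> x; apply: cvg_norm; apply: cvgB; [exact: cf|exact: cvg_cst].
  exact: continuous_integrable_itv.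
Qed.

(** Real differentiability of (u, v) at (p, q) with derivative the
    multiplication by c + i s. Continuity of the partial derivatives is not
    assumed, which is why the integral theorem below needs a bisection. *)
Definition cauchy_riemann u v p q := exists c s, forall e, 0 < e ->
  exists2 d, 0 < d & forall x y, `|x - p| < d -> `|y - q| < d ->
    `|u x y - u p q - (c * (x - p) - s * (y - q))| <= e * (`|x - p| + `|y - q|) /\
    `|v x y - v p q - (s * (x - p) + c * (y - q))| <= e * (`|x - p| + `|y - q|).

(** The integral of u dx - v dy around the boundary of the rectangle, with
    opposite sides paired; the pairing makes the linear part of (u, v)
    contribute constants only. *)
Definition boundary_int u v x1 x2 y1 y2 :=
  segint (fun x => u x y1 - u x y2) x1 x2 + segint (fun y => v x1 y - v x2 y) y1 y2.

(** The lower left corners of the successive quarters form nondecreasing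
    bounded sequences; their suprema are the coordinates of the common point.
    *)
Lemma quarter_bisection (bad : nat -> R -> R -> Prop) (x0 y0 a b : R) :
  0 <= a -> 0 <= b -> bad 0%N x0 y0 ->
  (forall n x y, bad n x y -> exists x' y',
     [/\ bad n.+1 x' y', x <= x' <= x + a / 2 ^+ n.+1 & y <= y' <= y + b / 2 ^+ n.+1]) ->
  exists p q, forall n, exists x y,
    [/\ bad n x y, x <= p <= x + a / 2 ^+ n & y <= q <= y + b / 2 ^+ n].
Proof.
move=> a0 b0 bad0 step.
have stepN n (z : R * R) : exists z' : R * R, bad n z.1 z.2 ->
  [/\ bad n.+1 z'.1 z'.2, z.1 <= z'.1 <= z.1 + a / 2 ^+ n.+1 &
      z.2 <= z'.2 <= z.2 + b / 2 ^+ n.+1].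
  have [/step[x' [y' h]]|nb] := pselect (bad n z.1 z.2); first by exists (x', y').
  by exists z.
have [s sP] := choice (fun nz : nat * (R * R) => stepN nz.1 nz.2).
pose w := fix w n := if n is m.+1 then s (m, w m) else (x0, y0).
have wbad n : bad n (w n).1 (w n).2.
  by elim: n => // n /(sP (n, w n))[].
have half (c : R) n : c / 2 ^+ n = c / 2 ^+ n.+1 + c / 2 ^+ n.+1.
  by rewrite exprS; field; rewrite expf_neq0.
have key (c : R) (r : nat -> R) : 0 <= c ->
    (forall n, r n <= r n.+1 <= r n + c / 2 ^+ n.+1) ->
    exists p, forall n, r n <= p <= r n + c / 2 ^+ n.
  move=> c0 rP.
  have inc n m : r n <= r (n + m)%N.
    elim: m => [|m IH]; first by rewrite addn0.
    by rewrite addnS (le_trans IH)//; case/andP: (rP (n + m)%N).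
  have dec n m : r (n + m)%N + c / 2 ^+ (n + m)%N <= r n + c / 2 ^+ n.
    elim: m => [|m IH]; first by rewrite addn0.
    by rewrite addnS; move: IH (rP (n + m)%N); rewrite (half c (n + m)%N); lra.
  have pos n : 0 <= c / 2 ^+ n by rewrite divr_ge0// exprn_ge0.
  have ub n m : r m <= r n + c / 2 ^+ n.
    have [nm|/ltnW mn] := leqP n m.
      by have := dec n (m - n)%N; rewrite subnKC//; have := pos m; lra.
    by have := inc m (n - m)%N; rewrite subnKC//; have := pos n; lra.
  have hs : has_sup (range r).
    split; first by exists (r 0%N), 0%N.
    by exists (r 0%N + c / 2 ^+ 0) => _ [m _ <-].
  exists (sup (range r)) => n; apply/andP; split.
    by apply: (sup_upper_bound hs); exists n.
  by apply: (sup_le_ub hs.1) => _ [m _ <-].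
have [p pP] := key a (fun n => (w n).1) a0 (fun n => let: And3 _ h _ := sP (n, w n) (wbad n) in h).
have [q qP] := key b (fun n => (w n).2) b0 (fun n => let: And3 _ _ h := sP (n, w n) (wbad n) in h).
by exists p, q => n; exists (w n).1, (w n).2; split.
Qed.

Lemma affine_approx_continuous f :
  (forall x, exists c, exists2 d : R, 0 < d &
     forall t, `|t - x| < d -> `|f t - f x - c * (t - x)| <= `|t - x|) ->
  continuous f.
Proof.
move=> fP x; apply/cvgrPdist_lt => e e0.
have [c [d d0 dP]] := fP x.
have m0 : 0 < `|c| + 1 by rewrite ltr_wpDl.
exists (Num.min d (e / (`|c| + 1))) => /=; first by rewrite lt_min d0 divr_gt0.
move=> t /=; rewrite distrC [X in _ -> X < _]distrC lt_min => /andP[/dP h].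
rewrite ltr_pdivlMr// => te.
have -> : f t - f x = (f t - f x - c * (t - x)) + c * (t - x) by ring.
by apply: (le_lt_trans (ler_normD _ _)); rewrite normrM; lra.
Qed.

Section Goursat_rectangle.
Variables u v : R -> R -> R.
Hypothesis uv : forall p q, cauchy_riemann u v p q.

Lemma cauchy_riemann_contu y : continuous (u^~ y).
Proof.
apply: affine_approx_continuous => x.
have [c [s /(_ 1 ltr01)[d d0 dP]]] := uv x y.
exists c, d => // t tx; have := dP t y tx; rewrite subrr normr0 => /(_ d0)[+ _].
by rewrite mulr0 subr0 addr0 mul1r.
Qed.

Lemma cauchy_riemann_contv x : continuous (v x).
Proof.
apply: affine_approx_continuous => y.
have [c [s /(_ 1 ltr01)[d d0 dP]]] := uv x y.
exists c, d => // t ty; have := dP x t; rewrite subrr normr0 => /(_ d0 ty)[_ +].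
by rewrite mulr0 add0r add0r mul1r.
Qed.

Let cu y1 y2 : continuous (fun x => u x y1 - u x y2).
Proof. by move=> x; apply: cvgB; exact: cauchy_riemann_contu. Qed.

Let cv x1 x2 : continuous (fun y => v x1 y - v x2 y).
Proof. by move=> x; apply: cvgB; exact: cauchy_riemann_contv. Qed.

Let splitx x1 x2 x3 y1 y2 : x1 <= x2 -> x2 <= x3 ->
  boundary_int u v x1 x3 y1 y2 = boundary_int u v x1 x2 y1 y2 + boundary_int u v x2 x3 y1 y2.
Proof.
move=> h1 h2; rewrite /boundary_int (segint_split _ h1 h2)//.
rewrite !segintB; try exact: cauchy_riemann_contv; try exact: cauchy_riemann_contu.
by ring.
Qed.

Let splity x1 x2 y1 y2 y3 : y1 <= y2 -> y2 <= y3 ->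
  boundary_int u v x1 x2 y1 y3 = boundary_int u v x1 x2 y1 y2 + boundary_int u v x1 x2 y2 y3.
Proof.
move=> h1 h2; rewrite /boundary_int.
rewrite (@segint_split (fun y => v x1 y - v x2 y) y1 y2 y3)//.
rewrite !segintB; try exact: cauchy_riemann_contv; try exact: cauchy_riemann_contu.
by ring.
Qed.

Let local_bound p q e : 0 < e -> exists2 d, 0 < d & forall x y a b,
  0 <= a -> 0 <= b -> a < d -> b < d -> x <= p <= x + a -> y <= q <= y + b ->
  `|boundary_int u v x (x + a) y (y + b)| <= e * (a + b) ^+ 2.
Proof.
move=> e0; have [c [s csP]] := uv p q.
have [d d0 dP] := csP (e / 2) ltac:(by rewrite divr_gt0).
exists d => // x y a b a0 b0 ad bd /andP[xp px] /andP[yq qy].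
have in1 t : x <= t <= x + a -> `|t - p| <= a.
  by move=> /andP[xt tx]; rewrite ler_norml; lra.
have in2 t : y <= t <= y + b -> `|t - q| <= b.
  by move=> /andP[xt tx]; rewrite ler_norml; lra.
have e2 : 0 < e / 2 by rewrite divr_gt0.
have main t r : x <= t <= x + a -> y <= r <= y + b ->
    `|u t r - u p q - (c * (t - p) - s * (r - q))| <= e / 2 * (a + b) /\
    `|v t r - v p q - (s * (t - p) + c * (r - q))| <= e / 2 * (a + b).
  move=> /in1 t1 /in2 r1.
  have [h1 h2] := dP t r (le_lt_trans t1 ad) (le_lt_trans r1 bd).
  have hh : e / 2 * (`|t - p| + `|r - q|) <= e / 2 * (a + b).
    by rewrite ler_pM2l// lerD.
  by split; [exact: le_trans h1 hh|exact: le_trans h2 hh].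
have yy : y <= y <= y + b by rewrite lexx lerDl.
have yb : y <= y + b <= y + b by rewrite lexx lerDl b0.
have xx : x <= x <= x + a by rewrite lexx lerDl.
have xa : x <= x + a <= x + a by rewrite lexx lerDl a0.
have U := @segint_near (fun t => u t y - u t (y + b)) x (x + a) (s * b) (e * (a + b)).
have V := @segint_near (fun t => v x t - v (x + a) t) y (y + b) (- s * a) (e * (a + b)).
have {}U : `|segint (fun t => u t y - u t (y + b)) x (x + a) - s * b * a| <= e * (a + b) * a.
  have Ea : x + a - x = a by ring.
  rewrite Ea in U.
  apply: U => //; first by rewrite lerDl.
  move=> t tx; have [h1 _] := main t y tx yy; have [h2 _] := main t (y + b) tx yb.
  move: h1 h2; rewrite !ler_norml; lra.
have {}V : `|segint (fun t => v x t - v (x + a) t) y (y + b) - - s * a * b| <= e * (a + b) * b.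
  have Eb : y + b - y = b by ring.
  rewrite Eb in V.
  apply: V => //; first by rewrite lerDl.
  move=> t tx; have [_ h1] := main x t xx tx; have [_ h2] := main (x + a) t xa tx.
  move: h1 h2; rewrite !ler_norml; lra.
rewrite /boundary_int; move: (segint _ _ _) (segint _ _ _) U V => S1 S2.
rewrite !ler_norml; nra.
Qed.

(** If the integral around some rectangle were nonzero, repeated quartering
    would give rectangles shrinking to a point whose boundary integrals are at
    least a fixed multiple of their areas. At that point the affine
    approximation of (u, v) contributes nothing, and the error term is of
    smaller order than the area: a contradiction. *)
Theorem goursat_rectangle x1 x2 y1 y2 : x1 <= x2 -> y1 <= y2 ->
  boundary_int u v x1 x2 y1 y2 = 0.
Proof.
move=> x12 y12; apply/eqP/negPn/negP => D0.
set D := boundary_int u v; set eta := `|D x1 x2 y1 y2|.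
have eta0 : 0 < eta by rewrite normr_gt0.
pose a := x2 - x1; pose b := y2 - y1.
have a0 : 0 <= a by rewrite subr_ge0.
have b0 : 0 <= b by rewrite subr_ge0.
(* Each quartering costs at most a factor 4, as much as the area decreases. *)
pose bad n x y := eta / 4 ^+ n <= `|D x (x + a / 2 ^+ n) y (y + b / 2 ^+ n)|.
have pos (c : R) n : 0 <= c -> 0 <= c / 2 ^+ n.
  by move=> c0; rewrite divr_ge0// exprn_ge0.
have half (c : R) n : c / 2 ^+ n = c / 2 ^+ n.+1 + c / 2 ^+ n.+1.
  by rewrite exprS; field; rewrite expf_neq0.
have bad0 : bad 0%N x1 y1.
  by rewrite /bad !expr0 !divr1 /a /b ![_ + (_ - _)]addrC !subrK.
have step n x y : bad n x y -> exists x' y',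
     [/\ bad n.+1 x' y', x <= x' <= x + a / 2 ^+ n.+1 & y <= y' <= y + b / 2 ^+ n.+1].
  rewrite /bad (half a) (half b).
  have := pos a n.+1 a0; have := pos b n.+1 b0.
  set A := a / _; set B := b / _ => B0 A0.
  rewrite /D !addrA (@splitx x (x + A) (x + A + A)); try by rewrite lerDl.
  rewrite !(@splity _ _ y (y + B) (y + B + B)); try by rewrite lerDl.
  rewrite -/D.
  have -> : eta / 4 ^+ n = eta / 4 ^+ n.+1 * 4.
    by rewrite exprS; field; rewrite expf_neq0.
  set E := eta / _ => h.
  have [h1|h1] := leP E `|D x (x + A) y (y + B)|.
    by exists x, y; rewrite h1 !lexx !lerDl A0 B0.
  have [h2|h2] := leP E `|D x (x + A) (y + B) (y + B + B)|.
    by exists x, (y + B); rewrite h2 !lexx !lerDl A0 B0.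
  have [h3|h3] := leP E `|D (x + A) (x + A + A) y (y + B)|.
    by exists (x + A), y; rewrite h3 !lexx !lerDl A0 B0.
  have [h4|h4] := leP E `|D (x + A) (x + A + A) (y + B) (y + B + B)|.
    by exists (x + A), (y + B); rewrite h4 !lexx !lerDl A0 B0.
  exfalso; move: h; apply/negP; rewrite -ltNge.
  by move: h1 h2 h3 h4; rewrite !ltr_norml; lra.
have [p [q pq]] := quarter_bisection a0 b0 bad0 step.
have s0 : 0 < (a + b) ^+ 2 + 1 by rewrite ltr_wpDl ?sqr_ge0.
have [d d0 dP] := @local_bound p q (eta / ((a + b) ^+ 2 + 1)) (divr_gt0 eta0 s0).
have [n nP] : exists n, (a + b) / 2 ^+ n < d.
  have [n nP] : exists n : nat, (a + b) / d < n%:R.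
    exists (Num.bound ((a + b) / d)).
    by apply: archi_boundP; apply: divr_ge0; [exact: addr_ge0|exact: ltW].
  exists n; rewrite ltr_pdivrMr ?exprn_gt0//.
  rewrite ltr_pdivrMr// in nP; apply: (lt_le_trans nP).
  rewrite mulrC ler_pM2l//.
  by rewrite -natrX ler_nat ltnW// ltn_expl.
have [x [y [h xp yq]]] := pq n.
have an := pos a n a0; have bn := pos b n b0.
have := dP x y _ _ an bn _ _ xp yq.
have E : (a + b) / 2 ^+ n = a / 2 ^+ n + b / 2 ^+ n by rewrite mulrDl.
move=> /(_ ltac:(by rewrite E in nP; lra) ltac:(by rewrite E in nP; lra)).
rewrite -E => h'; have := le_trans h h'.
apply/negP; rewrite -ltNge expr_div_n -exprM mulnC exprM -[2 ^+ 2]/(2 * 2) -natrM.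
rewrite mulrA ltr_pM2r ?invr_gt0 ?exprn_gt0//.
by rewrite mulrAC ltr_pdivrMr// ltr_pM2l// ltrDl.
Qed.

End Goursat_rectangle.

(** On a rectangle spanning one period the two horizontal sides cancel, so the
    two vertical integrals agree. *)
Lemma periodic_mean_const u v x1 x2 c : (forall p q, cauchy_riemann u v p q) ->
  0 <= c -> (forall x, u x c = u x 0) ->
  segint (v x1) 0 c = segint (v x2) 0 c.
Proof.
move=> uv c0 per.
wlog le12 : x1 x2 / x1 <= x2.
  move=> W; have [/W//|/ltW/W ->//] := leP x1 x2.
have := goursat_rectangle uv le12 c0.
rewrite /boundary_int.
rewrite !segintB; try exact: (cauchy_riemann_contv uv); try exact: (cauchy_riemann_contu uv).
have -> : u^~ c = u^~ 0 by apply/funext => x; exact: per.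
by rewrite subrr add0r => /subr0_eq.
Qed.

End Goursat.

(** * Circle means of entire functions *)
Section CircleMeans.
Context {R : realType}.
Local Notation C := R[i].
Implicit Types (z w : C) (h k : C -> C) (s t x y : R).

(** Multiplication by the complex derivative is the real derivative of (Re h,
    Im h). *)
Lemma entire_cauchy_riemann h p q : entire h ->
  cauchy_riemann (fun x y => complex.Re (h (x +i* y)))
                 (fun x y => complex.Im (h (x +i* y))) p q.
Proof.
move=> hh; have [l hl] := entire_cderiv (p +i* q) hh.
exists (complex.Re l), (complex.Im l) => e e0.
have [d d0 dP] := hl e e0.
exists (d / 2) => [|x y xp yq]; first by rewrite divr_gt0.
set t := (x - p) +i* (y - q).
have tE : cmod t <= `|x - p| + `|y - q| by exact: cmod_le_ReIm.
have td : cmod t < d by apply: (le_lt_trans tE); lra.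
have := dP t td; rewrite /t.
have -> : p +i* q + ((x - p) +i* (y - q)) = x +i* y.
  by apply/eqP; rewrite eq_complex /= ![_ + (_ - _)]addrC !subrK !eqxx.
rewrite -/t; have e1 : e * cmod t <= e * (`|x - p| + `|y - q|) by rewrite ler_pM2l.
move: (h (x +i* y)) (h (p +i* q)) l {hl dP} => [a b] [a' b'] [c s] h0.
have {}h0 := le_trans h0 e1.
have := le_trans (cmod_Re _) h0; have := le_trans (cmod_Im _) h0.
rewrite /t /= => h1 h2; split; [congr (`|_| <= _): h2|congr (`|_| <= _): h1]; ring.
Qed.

Definition cis t : C := cos t +i* sin t.

Lemma cis_cexp t : cis t = cexp (0 +i* t).
Proof. by rewrite /cis /cexp /= expR0 !mul1r. Qed.

Lemma cexp_polar x y : cexp (x +i* y) = (expR x)%:C * cis y.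
Proof.
by rewrite /cexp /cis /=; apply/eqP; rewrite eq_complex /= !mul0r subr0 addr0 !eqxx.
Qed.

Let twopi_ge0 : 0 <= 2 * pi :> R. Proof. by rewrite mulr_ge0// pi_ge0. Qed.

Lemma cis2pi : cis (2 * pi) = cis 0.
Proof. by rewrite /cis mulr_natl cos2pi sin2pi cos0 sin0. Qed.

Lemma ReiM z : complex.Im ('i%C * z) = complex.Re z.
Proof. by case: z => a b /=; rewrite mul0r add0r mul1r. Qed.

Lemma periodic_vertical_int h : entire h ->
  (forall x, h (x +i* (2 * pi)) = h (x +i* 0)) -> forall x1 x2,
  segint (fun t => complex.Re (h (x1 +i* t))) 0 (2 * pi) =
  segint (fun t => complex.Re (h (x2 +i* t))) 0 (2 * pi).
Proof.
move=> hh per x1 x2.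
(* The vertical integrals in Goursat's lemma involve imaginary parts; the
   factor i turns these into real parts. *)
have CR p q := @entire_cauchy_riemann (fun z => 'i%C * h z) p q (@entireZ _ 'i%C _ hh).
have E x : (fun t => complex.Re (h (x +i* t))) =
    (fun t => complex.Im ('i%C * h (x +i* t))).
  by apply/funext => t; rewrite ReiM.
rewrite !E; apply: (@periodic_mean_const _ _ _ x1 x2 (2 * pi) CR twopi_ge0) => x.
by rewrite per.
Qed.

Lemma vertical_continuous h x : entire h ->
  continuous (fun t => complex.Re (h (x +i* t))).
Proof.
move=> hh.
have CR p q := @entire_cauchy_riemann (fun z => 'i%C * h z) p q (@entireZ _ 'i%C _ hh).
have -> : (fun t => complex.Re (h (x +i* t))) =
    (fun t => complex.Im ('i%C * h (x +i* t))).
  by apply/funext => t; rewrite ReiM.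
exact: (@cauchy_riemann_contv _ _ _ CR x).
Qed.

(** In logarithmic coordinates a circle about 0 is a vertical segment, and the
    mean does not change when this segment moves to the left, that is, when the
    circle shrinks to its centre. *)
Lemma circle_mean_value h z : entire h ->
  segint (fun t => complex.Re (h (cis t * z))) 0 (2 * pi) =
  complex.Re (h 0) * (2 * pi).
Proof.
move=> hh.
pose P w := h (cexp w * z).
have eP : entire P.
  exact: (@entire_comp R h (fun w => cexp w * z) hh
    (@entireM R cexp (fun=> z) (@entire_cexp R) (@entire_cst R z))).
have PP x : P (x +i* (2 * pi)) = P (x +i* 0) by rewrite /P !cexp_polar cis2pi.
have [l hl] := entire_cderiv 0 hh.
have -> : (fun t => complex.Re (h (cis t * z))) = (fun t => complex.Re (P (0 +i* t))).
  by apply/funext => t; rewrite /P cis_cexp.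
apply/eqP; rewrite -subr_eq0 -normr_le0; apply/ler_addgt0Pr => e e0; rewrite add0r.
have tp : 0 < 2 * pi + 1 :> R by rewrite ltr_wpDl.
have [d d0 dP] := cderiv_cont hl (divr_gt0 e0 tp).
have z1 : 0 < cmod z + 1 by rewrite ltr_wpDl// cmod_ge0.
pose s := ln (d / (cmod z + 1)).
rewrite (periodic_vertical_int eP PP 0 s).
have h1 := @segint_near R _ 0 (2 * pi) (complex.Re (h 0)) (e / (2 * pi + 1))
  (@vertical_continuous P s eP) twopi_ge0.
rewrite subr0 in h1; apply: (le_trans (h1 _)).
  move=> t _; rewrite /P cexp_polar.
  have : cmod ((expR s)%:C * cis t * z) < d.
    rewrite !cmodM cmodR ger0_norm ?expR_ge0// lnK ?posrE ?divr_gt0//.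
    rewrite cis_cexp cmod_cexp /= expR0 mulr1 mulrAC ltr_pdivrMr//.
    by rewrite ltr_pM2l// ltrDl.
  move=> /dP; rewrite add0r => /ltW; apply: le_trans.
  by rewrite -raddfB; exact: cmod_Re.
rewrite mulrAC ler_pdivrMr// ler_pM2l//.
by rewrite lerDl.
Qed.

(** The product h(e^w z) conj(k(r e^(- conj w) z)) is entire and 2 pi
    i-periodic in w, because k is conjugated together with its argument. Its
    vertical means at Re w = ln r and at Re w = 0 are the two sides. This
    replaces the comparison of Taylor coefficients when the adjoint of a
    dilation is computed. *)
Lemma circle_dilation_swap h k r z : entire h -> entire k -> 0 < r ->
  segint (fun t => complex.Re (h (r%:C * (cis t * z)) * (k (cis t * z))^*%C)) 0 (2 * pi) =
  segint (fun t => complex.Re (h (cis t * z) * (k (r%:C * (cis t * z)))^*%C)) 0 (2 * pi).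
Proof.
move=> hh hk r0.
pose P w := h (cexp w * z) * (k (cexp (- w) * (r%:C * z^*%C))^*%C)^*%C.
have eP : entire P.
  have eN : entire (fun w : C => - w).
    have := @entireZ R (-1) id (@entire_id R).
    by congr entire; apply/funext => w; rewrite mulN1r.
  have e1 := @entire_comp R h (fun w => cexp w * z) hh
    (@entireM R cexp (fun=> z) (@entire_cexp R) (@entire_cst R z)).
  have e2 := @entireM R _ _ (@entire_comp R cexp _ (@entire_cexp R) eN)
    (@entire_cst R (r%:C * z^*%C)).
  exact: (@entireM R _ _ e1 (@entire_comp R _ _ (entire_reflect hk) e2)).
have PE s t : P (s +i* t) = h ((expR s)%:C * (cis t * z)) *
    (k ((expR (- s) * r)%:C * (cis t * z)))^*%C.
  rewrite /P cexp_polar -mulrA; congr (_ * (k _)^*%C).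
  have -> : - (s +i* t) = (- s) +i* (- t) by [].
  rewrite cexp_polar; case: (z) => a b; apply/eqP; rewrite eq_complex /= cosN sinN.
  by apply/andP; split; apply/eqP; ring.
have PP x : P (x +i* (2 * pi)) = P (x +i* 0) by rewrite !PE cis2pi.
have := periodic_vertical_int eP PP (ln r) 0.
congr (segint _ _ _ = segint _ _ _); apply/funext => t; rewrite PE.
  by rewrite expRN lnK// mulVf ?lt0r_neq0// mul1r.
by rewrite oppr0 expR0 !mul1r.
Qed.

End CircleMeans.

(** * Maps of the plane that preserve area *)
Section PlaneMeasure.
Context {R : realType}.
Local Notation mu := (@lebesgue_measure R).
Local Notation plane := (measurableTypeR R * measurableTypeR R)%type.
Local Notation mu2 := (mu \x mu)%E.
Implicit Types (p q : plane) (x y a b c : R).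

(** An open set is the union of the boxes with rational centre and rational
    size that it contains. *)
Lemma box_open_measurable (U : set plane) :
  (forall p, U p -> exists2 d : R, 0 < d &
     forall q, `|q.1 - p.1| < d -> `|q.2 - p.2| < d -> U q) -> measurable U.
Proof.
move=> oU.
pose box (i : rat * rat * rat) : set plane :=
  [set x | x \in `](ratr i.1.1 - ratr i.2), (ratr i.1.1 + ratr i.2)[] `*`
  [set x | x \in `](ratr i.1.2 - ratr i.2), (ratr i.1.2 + ratr i.2)[].
pose F i : set plane := [set p | box i p /\ box i `<=` U].
have -> : U = \bigcup_i F i.
  apply/seteqP; split=> [p /oU[d d0 dP]|p [i _ [pi]]]; last exact.
  have d4 : 0 < d / 4 by rewrite divr_gt0.
  have d2 : d / 4 < d / 2 by lra.
  have [r] := rat_in_itvoo d2; rewrite in_itv /= => /andP[r0 rd].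
  have l x : x - d / 4 < x + d / 4 by lra.
  have [s1] := rat_in_itvoo (l p.1); rewrite in_itv /= => /andP[s1a s1b].
  have [s2] := rat_in_itvoo (l p.2); rewrite in_itv /= => /andP[s2a s2b].
  exists ((s1, s2), r) => //; split.
    by split; rewrite /= in_itv /=; lra.
  move=> q [] /=; rewrite !in_itv /= => q1 q2.
  by apply: dP; rewrite ltr_norml; lra.
apply: countable_bigcupT_measurable => // i.
have [h|h] := pselect (box i `<=` U).
  have -> : F i = box i by apply/seteqP; split=> [p []|].
  by apply: measurableX.
by have -> : F i = set0 by apply/seteqP; split=> [p []|].
Qed.

Lemma continuous_plane_measurable (f : plane -> R) :
  (forall p e, 0 < e -> exists2 d : R, 0 < d &
     forall q, `|q.1 - p.1| < d -> `|q.2 - p.2| < d -> `|f q - f p| < e) ->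
  measurable_fun setT f.
Proof.
move=> cf; apply: (measurability _ (measurable_realfun.RGenOInfty.measurableE R)) => _ [_ [x ->] <-].
rewrite setTI; apply: box_open_measurable => p /=; rewrite in_itv /= andbT => xp.
have [d d0 dP] := cf p (f p - x) ltac:(by rewrite subr_gt0).
exists d => // q q1 q2; rewrite /= in_itv /= andbT.
by have := dP q q1 q2; rewrite ltr_norml; lra.
Qed.

Lemma lebesgue_translation (f : measurableTypeR R -> \bar R) a : measurable_fun setT f ->
  (forall x, 0 <= f x)%E -> (\int[mu]_x f (x + a)%R = \int[mu]_x f x)%E.
Proof.
move=> mf f0.
pose phi : measurableTypeR R -> measurableTypeR R := fun x => x + a.
have mphi : measurable_fun setT phi by apply: measurable_funD.
transitivity (\int[pushforward mu phi]_x f x)%E.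
  by rewrite (ge0_integral_pushforward mphi)// preimage_setT.
apply: eq_measure_integral => A mA _; apply/esym.
apply: (@lebesgue_measure_unique R (pushforward mu phi)) => // _ [[b c]] _ <-.
change (mu `]b, c]%classic = mu (phi @^-1` `]b, c]%classic)).
have -> : phi @^-1` `]b, c]%classic = `](b - a), (c - a)]%classic.
  by apply/seteqP; split=> x; rewrite /phi /= !in_itv /= ltrBlDr lerBrDr.
rewrite !lebesgue_measure_itv/= !lte_fin ltrD2r.
by case: ifP => // _; rewrite -!EFinB; congr (_%:E); ring.
Qed.

(** Invariance is stated for integrals of nonnegative functions, so that such
    maps compose by rewriting. *)
Definition area_preserving (tau : plane -> plane) :=
  measurable_fun setT tau /\ forall f : plane -> \bar R, measurable_fun setT f ->
    (forall p, 0 <= f p)%E -> (\int[mu2]_p f (tau p) = \int[mu2]_p f p)%E.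

Lemma area_preserving_comp s t : area_preserving s -> area_preserving t ->
  area_preserving (fun p => s (t p)).
Proof.
move=> [ms hs] [mt ht]; split; first exact: (@measurableT_comp _ _ _ plane plane plane s setT t ms mt).
move=> f mf f0; have mfs := measurableT_comp mf ms.
by rewrite (ht (f \o s) mfs (fun p => f0 (s p))); exact: hs.
Qed.

(** By Tonelli's theorem it is enough to translate each horizontal line. *)
Lemma shear_fst_preserving c a : area_preserving (fun p => (p.1 + (c * p.2 + a), p.2)).
Proof.
have m : measurable_fun setT (fun p : plane => (p.1 + (c * p.2 + a), p.2) : plane).
  apply: measurable_fun_pair => //=.
  by apply: measurable_funD => //; apply: measurable_funD => //; apply: measurable_funM.
split=> // f mf f0.
rewrite (fubini_tonelli2 (fun p : plane => f (p.1 + (c * p.2 + a), p.2)))//; last first.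
  exact: (measurableT_comp mf m).
rewrite (fubini_tonelli2 f)//; apply: eq_integral => y _.
rewrite /fubini_G /=.
apply: (@lebesgue_translation (fun x => f (x, y))) => //.
by apply: measurableT_comp => //; exact: measurable_fun_pair.
Qed.

Lemma shear_snd_preserving c a : area_preserving (fun p => (p.1, p.2 + (c * p.1 + a))).
Proof.
have m : measurable_fun setT (fun p : plane => (p.1, p.2 + (c * p.1 + a)) : plane).
  apply: measurable_fun_pair => //=.
  by apply: measurable_funD => //; apply: measurable_funD => //; apply: measurable_funM.
split=> // f mf f0.
rewrite (fubini_tonelli1 (fun p : plane => f (p.1, p.2 + (c * p.1 + a))))//; last first.
  exact: (measurableT_comp mf m).
rewrite (fubini_tonelli1 f)//; apply: eq_integral => x _.
rewrite /fubini_F /=.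
apply: (@lebesgue_translation (fun y => f (x, y))) => //.
by apply: measurableT_comp => //; exact: measurable_fun_pair.
Qed.

Lemma translation_preserving a b : area_preserving (fun p => (p.1 + a, p.2 + b)).
Proof.
have := area_preserving_comp (shear_fst_preserving 0 a) (shear_snd_preserving 0 b).
by congr area_preserving; apply/funext => -[x y] /=; rewrite !mul0r !add0r.
Qed.

Definition rotate c a p : plane := (c * p.1 - a * p.2, a * p.1 + c * p.2).

(** A rotation by an angle other than pi is a product of three shears, with
    parameter t the tangent of half the angle; the half turn is the square of a
    quarter turn. *)
Lemma rotate_preserving c a : c ^+ 2 + a ^+ 2 = 1 -> area_preserving (rotate c a).
Proof.
move=> ca.
have main c' a' : c' ^+ 2 + a' ^+ 2 = 1 -> c' != -1 -> area_preserving (rotate c' a').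
  move=> ca' c1; have c0 : 1 + c' != 0 by rewrite addrC addr_eq0.
  pose t := a' / (1 + c').
  have := area_preserving_comp (shear_fst_preserving (- t) 0)
    (area_preserving_comp (shear_snd_preserving a' 0) (shear_fst_preserving (- t) 0)).
  congr area_preserving; apply/funext => -[x y] /=; rewrite /rotate /= !addr0.
  have t1 : t * a' = 1 - c'.
    apply: (mulIf c0); rewrite /t; transitivity (a' ^+ 2); first by field.
    have -> : a' ^+ 2 = 1 - c' ^+ 2 by rewrite -ca' addrC addKr.
    by ring.
  have t2 : t * (1 + c') = a' by rewrite /t; field.
  congr pair.
    transitivity (x * (1 - t * a') - (t * (1 + c') + t * (1 - c' - t * a')) * y).
      by ring.
    by rewrite t1 t2; ring.
  transitivity (a' * x + (1 - t * a') * y); first by ring.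
  by rewrite t1; ring.
have [c1|c1] := eqVneq c (-1); last exact: main.
have a0 : a = 0.
  apply/eqP; rewrite -sqrf_eq0; apply/eqP; apply: (addrI (c ^+ 2)).
  by rewrite ca addr0 c1 sqrrN expr1n.
have h : area_preserving (rotate 0 1).
  by apply: main; rewrite ?expr0n ?add0r ?expr1n// eq_sym oppr_eq0 oner_eq0.
have := area_preserving_comp h h; congr area_preserving; apply/funext => -[x y].
by rewrite /rotate /= c1 a0; congr pair; ring.
Qed.

Lemma area_preserving_integral t (f : plane -> \bar R) : area_preserving t ->
  measurable_fun setT f -> (\int[mu2]_p f (t p) = \int[mu2]_p f p)%E.
Proof.
move=> [mt ht] mf; rewrite integralE [RHS]integralE; congr (_ - _)%E.
  under eq_integral do rewrite (funepos_comp f t)/=.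
  by rewrite (ht f^\+%E)//; exact: measurable_funepos.
under eq_integral do rewrite (funeneg_comp f t)/=.
by rewrite (ht f^\-%E)//; exact: measurable_funeneg.
Qed.

Lemma area_preserving_integrable t (f : plane -> \bar R) : area_preserving t ->
  mu2.-integrable setT f -> mu2.-integrable setT (fun p => f (t p)).
Proof.
move=> ht /integrableP[mf If]; apply/integrableP; split.
  by case: ht => mt _; exact: measurableT_comp.
rewrite (@area_preserving_integral _ (fun p => `|f p|%E) ht)//.
exact: measurableT_comp.
Qed.

End PlaneMeasure.

(** * Averaging an integral over all rotations *)
Section Averaging.
Context {R : realType}.
Local Notation mu := (@lebesgue_measure R).
Local Notation line := (measurableTypeR R).
Local Notation plane := (measurableTypeR R * measurableTypeR R)%type.
Local Notation mu2 := (mu \x mu)%E.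
Implicit Types (p q : plane) (t : R).
Local Open Scope ereal_scope.

(** Products of the members of an exhaustion of the line exhaust the plane. *)
Lemma plane_sigma_finite : sigma_finite [set: plane] mu2.
Proof.
have /sigma_finiteP[F [FT ndF Fm]] := sigma_finiteT mu.
exists (fun n => F n `*` F n) => [|n].
  apply/seteqP; split=> // -[x y] _.
  have [[n _ Fx] [m _ Fy]] : (\bigcup_n F n) x /\ (\bigcup_n F n) y by rewrite -FT.
  exists (maxn n m) => //; split.
    by have /subsetPset := ndF n (maxn n m) (leq_maxl n m); exact.
  by have /subsetPset := ndF m (maxn n m) (leq_maxr n m); exact.
have [mFn finFn] := Fm n; split; first exact: measurableX.
by rewrite product_measure1E// lte_mul_pinfty// ge0_fin_numE.
Qed.

Definition area_measure : {sigma_finite_measure set plane -> \bar R} :=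
 HB.pack_for {sigma_finite_measure set plane -> \bar R} mu2
   (@Measure_isSigmaFinite.Build _ plane R mu2 plane_sigma_finite).

Let D : set line := `[0%R, (2 * pi)%R].

(** Each rotation preserves the integral, and Fubini's theorem exchanges the
    average over the angle with the integral over the plane. *)
Lemma average_over_rotations (F : plane -> \bar R) : mu2.-integrable setT F ->
  \int[mu2]_p \int[mu]_(t in D) F (rotate (cos t) (sin t) p) =
  (2 * pi)%:E * \int[mu2]_p F p.
Proof.
move=> iF; have mF := measurable_int _ iF.
have mD : measurable D by exact: measurable_itv.
pose f (z : line * plane) : \bar R :=
  (\1_D z.1)%:E * F (rotate (cos z.1) (sin z.1) z.2).
have mrot : measurable_fun setT
    (fun z : line * plane => rotate (cos z.1) (sin z.1) z.2 : plane).
  have mc : measurable_fun setT (fun z : line * plane => (cos z.1 : line)).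
    apply: (measurableT_comp _ measurable_fst).
    by apply: continuous_measurable_fun => x; exact: continuous_cos.
  have ms : measurable_fun setT (fun z : line * plane => (sin z.1 : line)).
    apply: (measurableT_comp _ measurable_fst).
    by apply: continuous_measurable_fun => x; exact: continuous_sin.
  have m1 : measurable_fun setT (fun z : line * plane => z.2.1).
    exact: (measurableT_comp measurable_fst measurable_snd).
  have m2 : measurable_fun setT (fun z : line * plane => z.2.2).
    exact: (measurableT_comp measurable_snd measurable_snd).
  apply: measurable_fun_pair.
    by apply: measurable_funB; exact: measurable_funM.
  by apply: measurable_funD; exact: measurable_funM.
have mf : measurable_fun setT f.
  apply: emeasurable_funM; last exact: (measurableT_comp mF mrot).
  apply/measurable_EFinP; apply: (measurableT_comp _ measurable_fst).
  exact: measurable_indic.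
have rotP t : area_preserving (rotate (cos t) (sin t)).
  by apply: rotate_preserving; rewrite cos2Dsin2.
have fD (G : line -> \bar R) : \int[mu]_t ((\1_D t)%:E * G t) = \int[mu]_(t in D) G t.
  rewrite [RHS]integral_mkcond; apply: eq_integral => t _.
  rewrite patchE indicE; by case: (t \in D); rewrite ?mul1e ?mul0e.
have muD : mu D = (2 * pi)%:E.
  rewrite /D lebesgue_measure_itv /= lte_fin mulr_gt0 ?pi_gt0//.
  by rewrite -EFinB subr0.
have Dcst c : \int[mu]_(t in D) c = c * (2 * pi)%:E.
  by rewrite -muD; exact: integral_cst.
have mFr t : measurable_fun setT (fun p => F (rotate (cos t) (sin t) p)).
  by case: (rotP t) => mr _; exact: (measurableT_comp mF mr).
have intf : (mu \x area_measure).-integrable setT f.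
  apply: (@integrable12ltyP _ _ line plane R mu area_measure f mf).2.
  under eq_integral.
    move=> t _; rewrite /f /=.
    under eq_integral do rewrite abseM gee0_abs ?lee_fin//.
    rewrite ge0_integralZl//; last exact: (measurableT_comp _ (mFr t)).
    rewrite (area_preserving_integral (rotP t) (f := fun p => `|F p|)); last first.
      exact: (measurableT_comp _ mF).
    over.
  rewrite fD Dcst muleC.
  apply: lte_mul_pinfty; rewrite ?lee_fin ?mulr_ge0 ?pi_ge0//.
  by case/integrableP: iF.
have := Fubini intf.
rewrite /f /=.
under eq_integral.
  move=> t _.
  rewrite integralZl//; last exact: (area_preserving_integrable (rotP t) iF).
  rewrite (area_preserving_integral (rotP t) mF); over.
rewrite fD Dcst => E.
rewrite muleC; refine (etrans _ (esym E)); apply: eq_integral => p _.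
by rewrite fD.
Qed.

Lemma eq_integral_of_eq_circle_means (F G : plane -> \bar R) :
  mu2.-integrable setT F -> mu2.-integrable setT G ->
  (forall p, \int[mu]_(t in D) F (rotate (cos t) (sin t) p) =
             \int[mu]_(t in D) G (rotate (cos t) (sin t) p)) ->
  \int[mu2]_p F p = \int[mu2]_p G p.
Proof.
move=> iF iG FG.
have pi0 : (2 * pi)%:E != 0 :> \bar R by rewrite eqe mulf_neq0// lt0r_neq0// pi_gt0.
have : (2 * pi)%:E * \int[mu2]_p F p = (2 * pi)%:E * \int[mu2]_p G p.
  by rewrite -!average_over_rotations//; apply: eq_integral => p _.
move/(congr1 (fun x => ((2 * pi)^-1)%:E * x)).
by rewrite !muleA -!EFinM mulVf ?mul1e.
Qed.

End Averaging.

(** * The Fock inner product *)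
Section FockBasics.
Context {R : realType}.
Local Notation C := R[i].
Local Notation mu := (@lebesgue_measure R).
Local Notation plane := (measurableTypeR R * measurableTypeR R)%type.
Local Notation mu2 := (mu \x mu)%E.
Implicit Types (h k l F G : C -> C) (z w a b : C) (p : plane).

Definition toC p : C := p.1 +i* p.2.

Lemma Re_normC_sqr z : complex.Re (`|z| ^+ 2) = cmod z ^+ 2.
Proof. by rewrite normC_cmod -rmorphXn. Qed.

Lemma gaussE z : gauss z = expR (- cmod z ^+ 2).
Proof. by rewrite /gauss Re_normC_sqr. Qed.

Lemma gauss_ge0 z : 0 <= gauss z. Proof. exact: expR_ge0. Qed.

Lemma measurable_Re_entire h : entire h ->
  measurable_fun setT (fun p => complex.Re (h (toC p))).
Proof.
move=> hh; apply: continuous_plane_measurable => p e e0.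
have [l hl] := entire_cderiv (toC p) hh.
have [d d0 dP] := cderiv_cont hl e0.
exists (d / 2) => [|q q1 q2]; first by rewrite divr_gt0.
have -> : toC q = toC p + ((q.1 - p.1) +i* (q.2 - p.2)).
  by apply/eqP; rewrite eq_complex /= ![_ + (_ - _)]addrC !subrK !eqxx.
rewrite -raddfB; apply: (le_lt_trans (cmod_Re _)); apply: dP.
by apply: (le_lt_trans (cmod_le_ReIm _)) => /=; lra.
Qed.

Lemma Im_ReMi z : complex.Im z = complex.Re (- 'i%C * z).
Proof. by case: z => x y /=; ring. Qed.

Lemma measurable_Im_entire h : entire h ->
  measurable_fun setT (fun p => complex.Im (h (toC p))).
Proof.
move=> hh; have := measurable_Re_entire (@entireZ R (- 'i%C) h hh).
by congr measurable_fun; apply/funext => p; rewrite -Im_ReMi.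
Qed.

Lemma measurable_gauss : measurable_fun setT (fun p => gauss (toC p)).
Proof.
have -> : (fun p => gauss (toC p)) =
    (fun p => expR (- (complex.Re (toC p) * complex.Re (toC p) +
      complex.Im (toC p) * complex.Im (toC p)))).
  by apply/funext => p; rewrite gaussE cmod_sqr !expr2.
apply: (measurableT_comp (@measurable_expR R)).
apply: (measurableT_comp (@oppr_measurable R _)).
have m1 := measurable_Re_entire (@entire_id R).
have m2 := measurable_Im_entire (@entire_id R).
by apply: measurable_funD; apply: measurable_funM.
Qed.

Definition sqweight h p : R := cmod (h (toC p)) ^+ 2 * gauss (toC p).

Lemma sqweight_ge0 h p : 0 <= sqweight h p.
Proof. by rewrite mulr_ge0 ?sqr_ge0 ?gauss_ge0. Qed.

Lemma measurable_sqweight h : entire h -> measurable_fun setT (sqweight h).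
Proof.
move=> hh; apply: measurable_funM; last exact: measurable_gauss.
have -> : (fun p => cmod (h (toC p)) ^+ 2) =
    (fun p => complex.Re (h (toC p)) * complex.Re (h (toC p)) +
      complex.Im (h (toC p)) * complex.Im (h (toC p))).
  by apply/funext => p; rewrite cmod_sqr !expr2.
have m1 := measurable_Re_entire hh; have m2 := measurable_Im_entire hh.
by apply: measurable_funD; apply: measurable_funM.
Qed.

(** A finite integral and integrability are the same for a nonnegative weight
    that is measurable, as it is for an entire function. *)
Lemma fockP h :
  fock h <-> entire h /\ mu2.-integrable setT (fun p => (sqweight h p)%:E).
Proof.
have E : (\int[area]_p (complex.Re (`|h (p.1 +i* p.2)| ^+ 2) * gauss (p.1 +i* p.2))%:E =
    \int[mu2]_p `|(sqweight h p)%:E|)%E.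
  apply: eq_integral => p _; rewrite Re_normC_sqr.
  by rewrite gee0_abs ?lee_fin ?sqweight_ge0.
have pi0 : 0 < pi^-1 :> R by rewrite invr_gt0 pi_gt0.
split=> -[hh]; rewrite ?E => H; split=> //.
  apply/integrableP; split.
    by apply/measurable_EFinP; exact: measurable_sqweight.
  have : (0 <= \int[mu2]_p `|(sqweight h p)%:E|)%E.
    by apply: integral_ge0 => p _; exact: abse_ge0.
  move: H; case: (\int[mu2]_p _)%E => [r _ _||//]; [exact: ltry|by rewrite gt0_muley].
rewrite E; case/integrableP: H => _ H.
by apply: lte_mul_pinfty; rewrite // lee_fin ltW.
Qed.

Lemma fock_entire h : fock h -> entire h. Proof. by case. Qed.

Definition cintegrable F :=
  mu2.-integrable setT (fun p => (complex.Re (F (toC p)))%:E) /\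
  mu2.-integrable setT (fun p => (complex.Im (F (toC p)))%:E).

Definition inner_integrand h k z : C := h z * (k z)^*%C * (gauss z)%:C.

Lemma Re_inner_integrand h k z : complex.Re (inner_integrand h k z) =
  (complex.Re (h z) * complex.Re (k z) + complex.Im (h z) * complex.Im (k z)) * gauss z.
Proof. by rewrite /inner_integrand; case: (h z) (k z) => [x y] [x' y'] /=; ring. Qed.

Lemma cmod_inner_integrand h k p :
  cmod (inner_integrand h k (toC p)) <= sqweight h p + sqweight k p.
Proof.
rewrite /inner_integrand !cmodM cmodJ cmodR ger0_norm ?gauss_ge0// /sqweight -mulrDl.
rewrite ler_wpM2r ?gauss_ge0//.
have := cmod_ge0 (h (toC p)); have := cmod_ge0 (k (toC p)).
by move: (cmod _) (cmod _) => x y x0 y0; nra.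
Qed.

(** The product |h| |k| is at most |h|^2 + |k|^2. *)
Lemma fock_inner_cintegrable h k : fock h -> fock k -> cintegrable (inner_integrand h k).
Proof.
move=> fh fk.
have main h' : fock h' -> mu2.-integrable setT
    (fun p => (complex.Re (inner_integrand h' k (toC p)))%:E).
  move=> /fockP[hh ih]; case/fockP: (fk) => hk ik.
  apply: (le_integrable _ _ _ (integrableD _ ih ik)) => //.
    apply/measurable_EFinP.
    under eq_fun do rewrite Re_inner_integrand.
    apply: measurable_funM; last exact: measurable_gauss.
    apply: measurable_funD; apply: measurable_funM.
    - exact: measurable_Re_entire.
    - exact: measurable_Re_entire.
    - exact: measurable_Im_entire.
    - exact: measurable_Im_entire.
  move=> p _; rewrite /= lee_fin.
  rewrite [X in _ <= X]ger0_norm ?addr_ge0 ?sqweight_ge0//.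
  exact: (le_trans (cmod_Re _) (cmod_inner_integrand _ _ _)).
split; first exact: main.
have fih : fock (fun z => - 'i%C * h z).
  case/fockP: fh => hh ih; apply/fockP; split; first exact: entireZ.
  congr (mu2.-integrable _ _): ih; apply/funext => p.
  by rewrite /sqweight cmodM (_ : cmod (- 'i%C) = 1) ?mul1r// cmodE /= oppr0 expr0n sqrrN expr1n add0r sqrtr1.
have := main _ fih; congr (mu2.-integrable _ _); apply/funext => p.
by rewrite [in RHS]Im_ReMi /inner_integrand !mulrA.
Qed.

Lemma area_integralE F : area_integral F =
  Rintegral mu2 setT (fun p => complex.Re (F (toC p))) +i*
  Rintegral mu2 setT (fun p => complex.Im (F (toC p))).
Proof. by []. Qed.

Lemma area_integralD a F G : cintegrable F -> cintegrable G ->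
  area_integral (fun z => a * F z + G z) = a * area_integral F + area_integral G.
Proof.
move=> [F1 F2] [G1 G2].
have Z r f : mu2.-integrable setT (fun p => (f p)%:E) ->
    mu2.-integrable setT (fun p => (r * f p)%:E).
  exact: integrableZl.
have L (r s : R) f g u : mu2.-integrable setT (fun p => (f p)%:E) ->
    mu2.-integrable setT (fun p => (g p)%:E) ->
    mu2.-integrable setT (fun p => (u p)%:E) ->
    Rintegral mu2 setT (fun p => r * f p + s * g p + u p) =
    r * Rintegral mu2 setT f + s * Rintegral mu2 setT g + Rintegral mu2 setT u.
  move=> If Ig Iu.
  have I1 := Z r _ If; have I2 := Z s _ Ig.
  have I12 : mu2.-integrable setT (fun p => (r * f p + s * g p)%:E).
    exact: (integrableD measurableT I1 I2).
  rewrite (RintegralD measurableT I12 Iu) (RintegralD measurableT I1 I2).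
  by rewrite !RintegralZl.
rewrite !area_integralE; case: a => x y.
have -> : (fun p => complex.Re ((x +i* y) * F (toC p) + G (toC p))) =
    (fun p => x * complex.Re (F (toC p)) + (- y) * complex.Im (F (toC p)) +
      complex.Re (G (toC p))).
  by apply/funext => p; case: (F _) (G _) => [u v] [u' v'] /=; ring.
have -> : (fun p => complex.Im ((x +i* y) * F (toC p) + G (toC p))) =
    (fun p => x * complex.Im (F (toC p)) + y * complex.Re (F (toC p)) +
      complex.Im (G (toC p))).
  by apply/funext => p; case: (F _) (G _) => [u v] [u' v'] /=; ring.
rewrite !L//; apply/eqP; rewrite eq_complex /=.
by apply/andP; split; apply/eqP; ring.
Qed.

Lemma fock_innerE h k : fock_inner h k = (pi^-1)%:C * area_integral (inner_integrand h k).
Proof. by []. Qed.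

Lemma fock_innerDl a h k l : fock h -> fock k -> fock l ->
  fock_inner (fun z => a * h z + k z) l = a * fock_inner h l + fock_inner k l.
Proof.
move=> fh fk fl; rewrite !fock_innerE [in RHS]mulrCA -mulrDr -area_integralD.
- congr (_ * area_integral _); apply/funext => z; rewrite /inner_integrand; ring.
- exact: fock_inner_cintegrable.
- exact: fock_inner_cintegrable.
Qed.

Lemma fock_inner_conj h k : fock h -> fock k ->
  fock_inner k h = (fock_inner h k)^*%C.
Proof.
move=> fh fk; have [_ iIm] := fock_inner_cintegrable fh fk.
rewrite !fock_innerE !area_integralE.
have -> : (fun p => complex.Re (inner_integrand k h (toC p))) =
    (fun p => complex.Re (inner_integrand h k (toC p))).
  apply/funext => p; rewrite /inner_integrand.
  by case: (h _) (k _) => [u v] [u' v'] /=; ring.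
have -> : (fun p => (complex.Im (inner_integrand k h (toC p)))) =
    (fun p => (- 1 * complex.Im (inner_integrand h k (toC p)))).
  apply/funext => p; rewrite /inner_integrand.
  by case: (h _) (k _) => [u v] [u' v'] /=; ring.
rewrite RintegralZl// mulN1r rmorphM; congr (_ * _).
by rewrite /= oppr0.
Qed.

Lemma fock_lin a h k : fock h -> fock k -> fock (fun z => a * h z + k z).
Proof.
move=> /fockP[hh ih] /fockP[hk ik]; apply/fockP.
have ha : entire (fun z => a * h z + k z) by exact: (entireD (@entireZ R a h hh) hk).
split => //.
have I1 : mu2.-integrable setT (fun p => (2 * cmod a ^+ 2 * sqweight h p)%:E).
  exact: (integrableZl measurableT _ ih).
have I2 : mu2.-integrable setT (fun p => (2 * sqweight k p)%:E).
  exact: (integrableZl measurableT _ ik).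
apply: (le_integrable _ _ _ (integrableD _ I1 I2)) => //.
  by apply/measurable_EFinP; exact: measurable_sqweight.
move=> p _; rewrite /= lee_fin.
rewrite !ger0_norm ?addr_ge0 ?mulr_ge0 ?exprn_ge0 ?sqweight_ge0 ?cmod_ge0 ?gauss_ge0//.
rewrite /sqweight !mulrA -mulrDl ler_wpM2r ?gauss_ge0//.
have := cmodD (a * h (toC p)) (k (toC p)).
have := cmod_ge0 (a * h (toC p) + k (toC p)); rewrite cmodM.
have := cmod_ge0 a; have := cmod_ge0 (h (toC p)); have := cmod_ge0 (k (toC p)).
move: (cmod (_ + _)) (cmod a) (cmod (h _)) (cmod (k _)) => s x y z z0 y0 x0 s0 s1.
have : s ^+ 2 <= (x * y + z) ^+ 2 by rewrite lerXn2r ?nnegrE ?addr_ge0 ?mulr_ge0.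
by have := sqr_ge0 (x * y - z); rewrite !expr2; nra.
Qed.

End FockBasics.

(** * Rotations and Weyl translations of the Fock space *)
Section FockSymmetries.
Context {R : realType}.
Local Notation C := R[i].
Local Notation mu := (@lebesgue_measure R).
Local Notation plane := (measurableTypeR R * measurableTypeR R)%type.
Local Notation mu2 := (mu \x mu)%E.
Implicit Types (h k l : C -> C) (z w a b m : C) (p : plane).

Lemma fock_plane_map tau h h' : area_preserving tau -> entire h' ->
  (forall p, sqweight h' p = sqweight h (tau p)) -> fock h -> fock h'.
Proof.
move=> pt hh' E /fockP[_ ih]; apply/fockP; split=> //.
by under eq_fun do rewrite E; exact: (area_preserving_integrable pt ih).
Qed.

(** Unitarity of a symmetry is reduced to a pointwise identity between
    integrands. *)
Lemma inner_plane_map tau h k h' k' : area_preserving tau -> fock h -> fock k ->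
  (forall p, inner_integrand h' k' (toC p) = inner_integrand h k (toC (tau p))) ->
  fock_inner h' k' = fock_inner h k.
Proof.
move=> pt fh fk E; rewrite !fock_innerE !area_integralE.
have [i1 i2] := fock_inner_cintegrable fh fk.
congr (_ * (fine _ +i* fine _)).
- under eq_integral do rewrite E.
  exact: (area_preserving_integral pt (measurable_int _ i1)).
- under eq_integral do rewrite E.
  exact: (area_preserving_integral pt (measurable_int _ i2)).
Qed.

Definition dilate m h : C -> C := fun z => h (m * z).

Lemma entire_dilate m h : entire h -> entire (dilate m h).
Proof.
move=> hh; exact: (@entire_comp R h (fun z => m * z) hh (@entireZ R m id (@entire_id R))).
Qed.

Lemma toC_rotate m p : toC (rotate (complex.Re m) (complex.Im m) p) = m * toC p.
Proof.
case: m p => a b [x y]; apply/eqP; rewrite eq_complex /=.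
by apply/andP; split; apply/eqP; ring.
Qed.

Lemma unimodular_preserving m : cmod m = 1 ->
  area_preserving (rotate (complex.Re m) (complex.Im m)).
Proof. by move=> m1; apply: rotate_preserving; rewrite -cmod_sqr m1 expr1n. Qed.

Lemma gauss_rotate m z : cmod m = 1 -> gauss (m * z) = gauss z.
Proof. by move=> m1; rewrite !gaussE cmodM m1 mul1r. Qed.

Lemma fock_rotation m h : cmod m = 1 -> fock h -> fock (dilate m h).
Proof.
move=> m1 fh; apply: (fock_plane_map (unimodular_preserving m1) _ _ fh).
  exact/entire_dilate/fock_entire.
by move=> p; rewrite /sqweight toC_rotate gauss_rotate.
Qed.

Lemma inner_rotation m h k : cmod m = 1 -> fock h -> fock k ->
  fock_inner (dilate m h) (dilate m k) = fock_inner h k.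
Proof.
move=> m1 fh fk; apply: (inner_plane_map (unimodular_preserving m1) fh fk) => p.
by rewrite /inner_integrand toC_rotate gauss_rotate.
Qed.

(** The Weyl operator: translation by b, with the weight that makes it unitary
    on the Fock space. *)
Definition weyl b h : C -> C :=
  fun u => h (b + u) * cexp (- (b^*%C * u) - (cmod b ^+ 2 / 2)%:C).

Lemma entire_weyl b h : entire h -> entire (weyl b h).
Proof.
move=> hh.
have e1 := @entire_comp R h (fun u => b + u) hh (entireD (@entire_cst R b) (@entire_id R)).
have e2 := entireD (@entireZ R (- b^*%C) id (@entire_id R))
   (@entire_cst R (- (cmod b ^+ 2 / 2)%:C)).
have e3 := entireM e1 (@entire_comp R cexp _ (@entire_cexp R) e2).
by congr entire: e3; apply/funext => u; rewrite /weyl mulNr.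
Qed.

(** Completing the square: the weight of the Weyl operator accounts exactly for
    the change of the Gaussian under translation. *)
Lemma weyl_gauss b z :
  cmod (cexp (- (b^*%C * z) - (cmod b ^+ 2 / 2)%:C)) ^+ 2 * gauss z = gauss (b + z).
Proof.
rewrite cmod_cexp !gaussE expr2 -!expRD !cmod_sqr; congr expR.
by case: b z => [x y] [u v] /=; field.
Qed.

Lemma toC_translate b p :
  toC (p.1 + complex.Re b, p.2 + complex.Im b) = b + toC p.
Proof. by case: b p => x y [u v]; apply/eqP; rewrite eq_complex /= ![_ + x]addrC ![_ + y]addrC !eqxx. Qed.

Lemma fock_weyl b h : fock h -> fock (weyl b h).
Proof.
move=> fh; apply: (fock_plane_map (translation_preserving (complex.Re b) (complex.Im b)) _ _ fh).
  exact/entire_weyl/fock_entire.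
by move=> p; rewrite /sqweight toC_translate -weyl_gauss /weyl cmodM exprMn mulrA.
Qed.

Lemma mul_conj_cmod z : z * z^*%C = (cmod z ^+ 2)%:C.
Proof. by rewrite -sqr_normc normC_cmod rmorphXn. Qed.

Lemma inner_weyl b h k : fock h -> fock k ->
  fock_inner (weyl b h) (weyl b k) = fock_inner h k.
Proof.
move=> fh fk; apply: (inner_plane_map
  (translation_preserving (complex.Re b) (complex.Im b)) fh fk) => p.
rewrite /inner_integrand toC_translate -weyl_gauss /weyl.
move: (cexp _) (h _) (k _) => E x y.
have -> : (cmod E ^+ 2 * gauss (toC p))%:C = E * E^*%C * (gauss (toC p))%:C.
  by rewrite mul_conj_cmod rmorphM.
by rewrite rmorphM; set c := E^*%C; set d := y^*%C; rewrite -/c -/d; ring.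
Qed.

Lemma weylK b h : weyl (- b) (weyl b h) =1 h.
Proof.
move=> z; rewrite /weyl addNKr -mulrA -cexpD cmodN rmorphN.
have -> : b^*%C * (- b + z) = b^*%C * z - (cmod b ^+ 2)%:C.
  by rewrite -mul_conj_cmod; ring.
have -> : (cmod b ^+ 2)%:C = (cmod b ^+ 2 / 2)%:C + (cmod b ^+ 2 / 2)%:C :> C.
  by rewrite -rmorphD /= -splitr.
by rewrite (_ : - _ - _ + _ = 0) ?cexp0 ?mulr1//; ring.
Qed.

Lemma circle_continuous h z : entire h ->
  continuous (fun t => complex.Re (h (cis t * z))).
Proof.
move=> hh.
have e := @entire_comp R h (fun w => cexp w * z) hh
    (@entireM R cexp (fun=> z) (@entire_cexp R) (@entire_cst R z)).
have -> : (fun t => complex.Re (h (cis t * z))) =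
    (fun t => complex.Re (h (cexp (0 +i* t) * z))).
  by apply/funext => t; rewrite cis_cexp.
exact: (@vertical_continuous R _ 0 e).
Qed.

Lemma circle_continuous_inner h k z : entire h -> entire k ->
  continuous (fun t => complex.Re (h (cis t * z) * (k (cis t * z))^*%C)).
Proof.
move=> hh hk.
have -> : (fun t => complex.Re (h (cis t * z) * (k (cis t * z))^*%C)) =
  (fun t => complex.Re (h (cis t * z)) * complex.Re (k (cis t * z)) +
   complex.Re (- 'i%C * h (cis t * z)) * complex.Re (- 'i%C * k (cis t * z))).
  apply/funext => t; case: (h _) (k _) => [x y] [u v] /=; ring.
have e1 := @entireZ R (- 'i%C) _ hh; have e2 := @entireZ R (- 'i%C) _ hk.
move=> t; apply: cvgD; apply: cvgM.
- exact: (@circle_continuous h z hh t).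
- exact: (@circle_continuous k z hk t).
- exact: (@circle_continuous _ z e1 t).
- exact: (@circle_continuous _ z e2 t).
Qed.

(** The Gaussian is constant on circles about the origin, so only the circle
    means of h conj k matter. *)
Lemma Re_inner_circle h k h' k' : fock h -> fock k -> fock h' -> fock k' ->
  (forall z, segint (fun t => complex.Re (h (cis t * z) * (k (cis t * z))^*%C)) 0 (2 * pi) =
             segint (fun t => complex.Re (h' (cis t * z) * (k' (cis t * z))^*%C)) 0 (2 * pi)) ->
  (\int[mu2]_p (complex.Re (inner_integrand h k (toC p)))%:E =
   \int[mu2]_p (complex.Re (inner_integrand h' k' (toC p)))%:E)%E.
Proof.
move=> fh fk fh' fk' E.
have [i1 _] := fock_inner_cintegrable fh fk.
have [i2 _] := fock_inner_cintegrable fh' fk'.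
have D (l g : C -> C) : fock l -> fock g -> forall p,
  (\int[mu]_(t in `[0%R, (2 * pi)%R])
     (complex.Re (inner_integrand l g (toC (rotate (cos t) (sin t) p))))%:E)%E =
  (segint (fun t => complex.Re (l (cis t * toC p) * (g (cis t * toC p))^*%C)) 0 (2 * pi)
   * gauss (toC p))%:E.
  move=> fl fg p.
  have c := @circle_continuous_inner l g (toC p) (fock_entire fl) (fock_entire fg).
  have ic := continuous_integrable_itv 0 (2 * pi) c.
  rewrite /segint -RintegralZr//.
  rewrite /Rintegral fineK; last first.
    apply: integrable_fin_num => //.
    exact: (integrableZr _ _ ic).
  apply: eq_integral => t _; congr (_%:E).
  rewrite /inner_integrand.
  have -> : toC (rotate (cos t) (sin t) p) = cis t * toC p by exact: (toC_rotate (cis t)).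
  rewrite gauss_rotate; last by rewrite cis_cexp cmod_cexp expR0.
  by case: (l _ * (g _)^*%C) => [x y] /=; ring.
apply: (eq_integral_of_eq_circle_means i1 i2) => p.
by rewrite !D// E.
Qed.

Lemma fockZ a h : fock h -> fock (fun z => a * h z).
Proof.
have f0 : fock (fun=> 0 : C).
  apply/fockP; split; first exact: entire_cst.
  apply: (eq_integrable _ (cst 0%E)) => //.
    by move=> p _; rewrite /sqweight cmod0 expr0n mul0r.
  exact: integrable0.
move=> fh; have := fock_lin a fh f0.
by congr fock; apply/funext => z; rewrite addr0.
Qed.

(** The factor a is used with the values 1 and - i, to reach real and imaginary
    parts. *)
Lemma inner_eq_of_circle_means h k h' k' : fock h -> fock k -> fock h' -> fock k' ->
  (forall a z,
    segint (fun t => complex.Re (a * h (cis t * z) * (k (cis t * z))^*%C)) 0 (2 * pi) =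
    segint (fun t => complex.Re (a * h' (cis t * z) * (k' (cis t * z))^*%C)) 0 (2 * pi)) ->
  fock_inner h k = fock_inner h' k'.
Proof.
move=> fh fk fh' fk' E; rewrite !fock_innerE !area_integralE.
congr (_ * (fine _ +i* fine _)).
  by apply: Re_inner_circle => // z; have := E 1 z; under eq_fun do rewrite mul1r;
   under [X in _ = segint X _ _]eq_fun do rewrite mul1r.
have := Re_inner_circle (fockZ (- 'i%C) fh) fk (fockZ (- 'i%C) fh') fk' (E (- 'i%C)).
congr (_ = _); apply: eq_integral => p _; rewrite [in RHS]Im_ReMi; congr (complex.Re _)%:E.
  by rewrite /inner_integrand !mulrA.
by rewrite /inner_integrand !mulrA.
Qed.

End FockSymmetries.

(** * Reproducing kernels and the adjoint of a dilation *)
Section ReproducingKernel.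
Context {R : realType}.
Local Notation C := R[i].
Local Notation mu := (@lebesgue_measure R).
Local Notation plane := (measurableTypeR R * measurableTypeR R)%type.
Local Notation mu2 := (mu \x mu)%E.
Implicit Types (h k l : C -> C) (z w a b m d : C) (p : plane).

Lemma integral_gauss_plane : (\int[mu2]_p (gauss (toC p))%:E = pi%:E)%E.
Proof.
have m : measurable_fun setT (fun p : plane => (gauss (toC p))%:E).
  by apply/measurable_EFinP; exact: measurable_gauss.
rewrite (fubini_tonelli1 _ m); last by move=> p; rewrite lee_fin gauss_ge0.
rewrite /fubini_F.
have G (r : R) : (\int[mu]_y (gauss (toC (r, y)))%:E = (gauss_fun r * Num.sqrt pi)%:E)%E.
  rewrite EFinM -integralT_gauss -integralZl//; last exact: integrableT_gauss.
  apply: eq_integral => y _; rewrite -EFinM gaussE cmod_sqr /gauss_fun -expRD opprD.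
  by [].
under eq_integral do rewrite G mulrC EFinM.
rewrite integralZl//; last exact: integrableT_gauss.
by rewrite integralT_gauss -EFinM -expr2 sqr_sqrtr// pi_ge0.
Qed.

Definition const1 : C -> C := fun=> 1.

Lemma fock_const1 : fock const1.
Proof.
apply/fockP; split; first exact: entire_cst.
have E : (fun p => (sqweight const1 p)%:E) = (fun p => (gauss (toC p))%:E).
  by apply/funext => p; rewrite /sqweight cmod1 expr1n mul1r.
rewrite E; apply/integrableP; split.
  by apply/measurable_EFinP; exact: measurable_gauss.
under eq_integral do rewrite gee0_abs ?lee_fin ?gauss_ge0//.
by rewrite integral_gauss_plane ltry.
Qed.

Lemma fock_inner0l l : fock l -> fock_inner (fun=> 0) l = 0.
Proof.
move=> fl; have := fock_innerDl (-1) fock_const1 fock_const1 fl.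
by rewrite mulN1r addNr; under eq_fun do rewrite mulN1r addNr.
Qed.

Lemma fock0 : fock (fun=> 0 : C).
Proof.
by have := fockZ 0 fock_const1; congr fock; apply/funext => z; rewrite mul0r.
Qed.

Lemma fock_innerZl a h l : fock h -> fock l ->
  fock_inner (fun z => a * h z) l = a * fock_inner h l.
Proof.
move=> fh fl; have := fock_innerDl a fh fock0 fl.
by rewrite fock_inner0l// addr0; under eq_fun do rewrite addr0.
Qed.

Lemma fock_innerZr a h l : fock h -> fock l ->
  fock_inner l (fun z => a * h z) = a^*%C * fock_inner l h.
Proof.
move=> fh fl; rewrite (fock_inner_conj (fockZ a fh) fl) fock_innerZl//.
by rewrite rmorphM [fock_inner l h](fock_inner_conj fh fl).
Qed.

Lemma fock_inner_const1 : fock_inner const1 const1 = 1.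
Proof.
rewrite fock_innerE area_integralE.
have -> : (fun p => complex.Re (inner_integrand const1 const1 (toC p))) =
    (fun p => gauss (toC p)).
  apply/funext => p; rewrite Re_inner_integrand /const1 /=.
  by rewrite mulr1 mulr0 addr0 mul1r.
have -> : (fun p => complex.Im (inner_integrand const1 const1 (toC p))) = (fun=> 0).
  by apply/funext => p; rewrite /inner_integrand /const1 /=; ring.
rewrite /Rintegral integral0 integral_gauss_plane /=.
apply/eqP; rewrite eq_complex /= !mulr0 mul0r subr0 addr0 mulVf ?eqxx//.
by rewrite lt0r_neq0// pi_gt0.
Qed.

Lemma fock_cst a : fock (fun=> a).
Proof.
by have := fockZ a fock_const1; congr fock; apply/funext => z; rewrite mulr1.
Qed.

Lemma fock_inner_cstl a l : fock l -> fock_inner (fun=> a) l = a * fock_inner const1 l.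
Proof.
move=> fl; have -> : (fun=> a) = (fun z => a * const1 z).
  by apply/funext => z; rewrite /const1 mulr1.
by apply: fock_innerZl => //; exact: fock_const1.
Qed.

(** By the mean value property, h and the constant h(0) have the same circle
    means. *)
Lemma reproducing0 h : fock h -> fock_inner h const1 = h 0.
Proof.
move=> fh; rewrite -[RHS]mulr1 -fock_inner_const1 -fock_inner_cstl; last exact: fock_const1.
apply: inner_eq_of_circle_means => //; try exact: fock_const1; first exact: fock_cst.
move=> a z; have hh := @entireZ R a _ (fock_entire fh).
have e : complex.Re (a * h 0) * (2 * pi) = complex.Re ((fun=> a * h 0) (0 : C)) * (2 * pi) by [].
have := @circle_mean_value R _ z hh.
rewrite /= e -(@circle_mean_value R _ z (@entire_cst R (a * h 0))).
by congr (segint _ _ _ = segint _ _ _); apply/funext => t; rewrite oppr0 (mulr1 (a * h _)).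
Qed.

Definition fock_ker w : C -> C := fun z => cexp (w^*%C * z).

(** Up to a positive factor the kernel at w is a Weyl translate of the constant
    1. *)
Lemma kernel_weyl w : fock_ker w =
  (fun z => (expR (cmod w ^+ 2 / 2))%:C * weyl (- w) const1 z).
Proof.
apply/funext => z; rewrite /fock_ker /weyl /const1 mul1r -cexpR -cexpD; congr cexp.
by rewrite cmodN rmorphN; ring.
Qed.

Lemma fock_kernel w : fock (fock_ker w).
Proof. by rewrite kernel_weyl; exact/fockZ/fock_weyl/fock_const1. Qed.

(** Weyl operators carry the evaluation at w to the evaluation at 0. *)
Lemma reproducing h w : fock h -> fock_inner h (fock_ker w) = h w.
Proof.
move=> fh; have f1 := fock_weyl (- w) fock_const1.
rewrite kernel_weyl fock_innerZr// -(inner_weyl w fh f1).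
have -> : weyl w (weyl (- w) const1) = const1.
  by apply/funext => z; rewrite -{1}[w]opprK weylK.
rewrite reproducing0; last exact: fock_weyl.
rewrite /weyl addr0 mulr0 oppr0 sub0r conjc_real -cexpR mulrCA -cexpD addrN cexp0.
by rewrite mulr1.
Qed.

Lemma dilateK m h : cmod m = 1 -> dilate m (dilate m^*%C h) = h.
Proof.
move=> m1; apply/funext => z; rewrite /dilate mulrA [_^*%C * _]mulrC mul_conj_cmod.
by rewrite m1 expr1n mul1r.
Qed.

(** Write d = r w with |w| = 1. The rotation w is moved to the other side by
    unitarity, and the dilation by r > 0 by comparing circle means. For d = 0
    both sides are products of values at the origin. *)
Lemma dilation_adjoint d h k : fock h -> fock k ->
  fock (dilate d h) -> fock (dilate d^*%C k) ->
  fock_inner (dilate d h) k = fock_inner h (dilate d^*%C k).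
Proof.
move=> fh fk fdh fdk.
have [d0|d0] := eqVneq d 0.
  have -> : dilate d h = (fun=> h 0).
    by apply/funext => z; rewrite /dilate d0 mul0r.
  have -> : dilate d^*%C k = (fun=> k 0).
    by apply/funext => z; rewrite /dilate d0 conjc0 mul0r.
  rewrite fock_inner_cstl// (fock_inner_conj fk fock_const1) reproducing0//.
  rewrite (fock_inner_conj (fock_cst (k 0)) fh) fock_inner_cstl//.
  rewrite (fock_inner_conj fh fock_const1) reproducing0//.
  by rewrite rmorphM [in RHS]mulrC; congr (_ * _); exact: esym (conjcK _).
have r0 := cmod_gt0 d0.
set r := cmod d in r0; set w := d / r%:C.
have rn : r%:C != 0 :> C by rewrite eq_complex /= eqxx andbT lt0r_neq0.
have w1 : cmod w = 1.
  by rewrite /w cmodM cmodV cmodR gtr0_norm// mulfV// lt0r_neq0.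
have dE : d = r%:C * w by rewrite /w mulrCA mulfV// mulr1.
have wJ1 : cmod w^*%C = 1 by rewrite cmodJ.
have E1 : dilate d h = dilate w (dilate r%:C h).
  by apply/funext => z; rewrite /dilate dE mulrA.
have E2 : dilate r%:C h = dilate w^*%C (dilate d h).
  by rewrite E1 -{2}[w]conjcK dilateK.
have E3 : dilate d^*%C k = dilate r%:C (dilate w^*%C k).
  have -> : d^*%C = r%:C * w^*%C.
    by rewrite [in LHS]dE rmorphM; congr (_ * _); exact: conjc_real.
  by apply/funext => z; rewrite /dilate mulrA [_ * r%:C]mulrC.
have f1 : fock (dilate r%:C h) by rewrite E2; exact: fock_rotation.
have f2 : fock (dilate w^*%C k) by exact: fock_rotation.
have f3 : fock (dilate r%:C (dilate w^*%C k)) by rewrite -E3.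
rewrite E1 E3 -{1}(dilateK k w1) inner_rotation//.
apply: inner_eq_of_circle_means => // a z.
by have := @circle_dilation_swap R _ _ r z (@entireZ R a _ (fock_entire fh)) (fock_entire f2) r0.
Qed.

End ReproducingKernel.

(** * Dilations about an arbitrary centre are normal *)
Section WeylDilation.
Context {R : realType}.
Local Notation C := R[i].
Implicit Types (h k l : C -> C) (z w a b m d c : C).

(** Up to a weight this is composition with the dilation by d about b: the
    normal form to which the weighted composition operator is brought. *)
Definition weyl_dilation b c d h : C -> C :=
  weyl (- b) (fun u => c * dilate d (weyl b h) u).

Lemma weylNK b h : weyl b (weyl (- b) h) = h.
Proof. by apply/funext => z; rewrite -{1}[b]opprK weylK. Qed.

Lemma weyl_weyl_dilation b c d h :
  weyl b (weyl_dilation b c d h) = (fun u => c * dilate d (weyl b h) u).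
Proof. exact: weylNK. Qed.

Lemma weyl_dilation_lin b c d a h k :
  weyl_dilation b c d (fun z => a * h z + k z) =1
  (fun z => a * weyl_dilation b c d h z + weyl_dilation b c d k z).
Proof. by move=> z; rewrite /weyl_dilation /weyl /dilate; ring. Qed.

Lemma weyl_dilation_comm b c c' d d' h :
  weyl_dilation b c d (weyl_dilation b c' d' h) =1
  weyl_dilation b c' d' (weyl_dilation b c d h).
Proof.
move=> z; rewrite /weyl_dilation !weylNK /weyl /dilate.
by rewrite [c * (c' * _)]mulrCA ![d' * (d * _)]mulrCA.
Qed.

(** Since d and its conjugate have equal moduli, the dilations by d and by conj
    d differ by a rotation; hence the boundedness of one gives that of the
    other. *)
Lemma exists_phase d : exists2 m, cmod m = 1 & d^*%C = d * m.
Proof.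
have [->|d0] := eqVneq d 0; first by exists 1; rewrite ?cmod1// conjc0 mul0r.
exists (d^*%C / d); last by rewrite mulrC divfK.
by rewrite cmodM cmodV cmodJ mulfV// lt0r_neq0// cmod_gt0.
Qed.

Section Bounded.
Variables (b c d : C).
Hypothesis c0 : c != 0.
Hypothesis bT : bounded_operator (weyl_dilation b c d).

Lemma fock_dilate_of_bounded h : fock h -> fock (dilate d h).
Proof.
move=> fh; have [fT _ _] := bT.
have := fockZ c^-1 (fock_weyl b (fT _ (fock_weyl (- b) fh))).
rewrite weyl_weyl_dilation weylNK.
by congr fock; apply/funext => z; rewrite mulKf.
Qed.

Lemma fock_dilateJ_of_bounded h : fock h -> fock (dilate d^*%C h).
Proof.
move=> fh; have [m m1 ->] := exists_phase d.
have := fock_rotation m1 (fock_dilate_of_bounded fh).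
by congr fock; apply/funext => z; rewrite /dilate mulrA.
Qed.

Lemma norm_weyl_dilationJ h : fock h ->
  fock_norm (weyl_dilation b c^*%C d^*%C h) = fock_norm (weyl_dilation b c d h).
Proof.
move=> fh; have fH := fock_weyl b fh.
have fd := fock_dilate_of_bounded fH; have fdJ := fock_dilateJ_of_bounded fH.
have E : fock_inner (dilate d^*%C (weyl b h)) (dilate d^*%C (weyl b h)) =
    fock_inner (dilate d (weyl b h)) (dilate d (weyl b h)).
  have [m m1 dm] := exists_phase d.
  have -> : dilate d^*%C (weyl b h) = dilate m (dilate d (weyl b h)).
    by apply/funext => z; rewrite /dilate dm mulrA.
  exact: (inner_rotation m1 fd fd).
rewrite /fock_norm /weyl_dilation.
rewrite (inner_weyl _ (fockZ _ fdJ) (fockZ _ fdJ)).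
rewrite (inner_weyl _ (fockZ _ fd) (fockZ _ fd)).
rewrite (fock_innerZl _ fdJ (fockZ _ fdJ)) (fock_innerZr _ fdJ fdJ) E.
rewrite (fock_innerZl _ fd (fockZ _ fd)) (fock_innerZr _ fd fd).
by rewrite conjcK mulrCA.
Qed.

(** The adjoint is the operator of the same family with conjugate parameters.
    It commutes with the given operator because dilations about the same centre
    commute. *)
Lemma weyl_dilation_normal : normal_operator (weyl_dilation b c d).
Proof.
split=> //; exists (weyl_dilation b c^*%C d^*%C).
have [fT _ [M MP]] := bT; split.
- split.
  + move=> h fh; apply/fock_weyl/fockZ/fock_dilateJ_of_bounded.
    exact: fock_weyl.
  + by move=> a h k _ _; exact: weyl_dilation_lin.
  + by exists M => h fh; rewrite norm_weyl_dilationJ//; exact: MP.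
- move=> h k fh fk; have fH := fock_weyl b fh; have fK := fock_weyl b fk.
  have fd := fock_dilate_of_bounded fH; have fdJ := fock_dilateJ_of_bounded fK.
  rewrite -(inner_weyl b (fT _ fh) fk) weyl_weyl_dilation.
  have fS : fock (weyl_dilation b c^*%C d^*%C k) by exact/fock_weyl/fockZ.
  rewrite -(inner_weyl b fh fS) weyl_weyl_dilation.
  rewrite (fock_innerZl _ fd fK) (fock_innerZr _ fdJ fH) conjcK.
  by rewrite (dilation_adjoint fH fK fd fdJ).
- by move=> h _; exact: weyl_dilation_comm.
Qed.

End Bounded.
End WeylDilation.

(** * The symbols of a self-adjoint weighted composition operator *)
Section SelfAdjointSymbols.
Context {R : realType}.
Local Notation C := R[i].
Implicit Types (h k f phi : C -> C) (z w a b m c l t : C).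

Lemma cderiv_uniq h z l m : cderiv h z l -> cderiv h z m -> l = m.
Proof.
move=> hl hm; apply/eqP; rewrite -subr_eq0; apply/negPn/negP => lm.
have e0 := cmod_gt0 lm.
have [d1 d10 h1] := hl (cmod (l - m) / 4) ltac:(by rewrite divr_gt0).
have [d2 d20 h2] := hm (cmod (l - m) / 4) ltac:(by rewrite divr_gt0).
pose s : R := Num.min d1 d2 / 2.
have m0 : 0 < Num.min d1 d2 by rewrite lt_min d10.
have s0 : 0 < s by rewrite divr_gt0.
have sd : s < Num.min d1 d2 by rewrite /s; lra.
have sE : cmod s%:C = s by rewrite cmodR gtr0_norm.
have {h1} := h1 s%:C; have {h2} := h2 s%:C.
move: sd; rewrite lt_min sE => /andP[sd1 sd2] /(_ sd2) h2 /(_ sd1) h1.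
have : cmod ((l - m) * s%:C) <= cmod (l - m) / 2 * s.
  have -> : (l - m) * s%:C = (h (z + s%:C) - h z - m * s%:C) - (h (z + s%:C) - h z - l * s%:C).
    by ring.
  by apply: (le_trans (cmodB _ _)); lra.
by rewrite cmodM sE ler_pM2r//; lra.
Qed.

(** Testing self-adjointness on two kernels gives f(z) exp(conj w phi(z)) =
    conj(f(w) exp(conj z phi(w))). Putting w = 0 determines f; then, for each
    w, an exponential is identically 1 in z, and its derivative at z = 0 shows
    that phi is affine. The slope equals its own conjugate. *)
Lemma selfadjoint_symbols f phi : entire phi -> (exists z, f z <> 0) ->
  self_adjoint (weighted_composition_op f phi) ->
  exists (f0 : C) (a : R), [/\ f0 != 0, forall z, f z = f0 * cexp ((phi 0)^*%C * z) &
    forall z, phi z = phi 0 + a%:C * z].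
Proof.
move=> hphi [z0 fz0] [[bW _ _] adjW].
set W := weighted_composition_op f phi in bW adjW.
have key z w : f z * cexp (w^*%C * phi z) = (f w * cexp (z^*%C * phi w))^*%C.
  have fw := bW _ (fock_kernel w); have fz := bW _ (fock_kernel z).
  have <- : fock_inner (W (fock_ker w)) (fock_ker z) = f z * cexp (w^*%C * phi z).
    by rewrite reproducing.
  rewrite adjW; try exact: fock_kernel.
  by rewrite (fock_inner_conj fz (fock_kernel w)) reproducing.
set c := phi 0; set f0 := f 0.
have f0J : f0^*%C = f0.
  by have := key 0 0; rewrite conjc0 !mul0r cexp0 !mulr1.
have fE z : f z = f0 * cexp (c^*%C * z).
  have := key z 0; rewrite conjc0 mul0r cexp0 mulr1 => ->.
  by rewrite conjCM f0J cexpJ conjCM conjcK [z * _]mulrC.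
have f00 : f0 != 0 by apply: contra_not_neq fz0 => f0E; rewrite fE f0E mul0r.
have [p hp] := entire_cderiv 0 hphi.
have phiE w : phi w = c + p^*%C * w.
  (* The difference of the two exponents is only known modulo 2 pi i;
     differentiating its exponential at 0 avoids the choice of a logarithm. *)
  pose A z := c^*%C * z + w^*%C * phi z - w^*%C * c - z * (phi w)^*%C.
  have A1 z : cexp (A z) = 1.
    have := key z w; rewrite !fE !conjCM f0J !cexpJ !conjCM !conjcK -!mulrA.
    move/(mulfI f00); rewrite -!cexpD => E.
    have -> : A z = (c^*%C * z + w^*%C * phi z) - (c * w^*%C + z * (phi w)^*%C).
      by rewrite /A; ring.
    by rewrite cexpB E mulfV// cexp_neq0.
  have hA : cderiv A 0 (c^*%C + w^*%C * p - (phi w)^*%C).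
    move=> e e0; have m0 : 0 < cmod w + 1 by rewrite ltr_wpDl// cmod_ge0.
    have [d d0 dP] := hp (e / (cmod w + 1)) (divr_gt0 e0 m0).
    exists d => // t /dP ht.
    have -> : A (0 + t) - A 0 - (c^*%C + w^*%C * p - (phi w)^*%C) * t =
      w^*%C * (phi (0 + t) - phi 0 - p * t) by rewrite /A; ring.
    rewrite cmodM cmodJ.
    apply: (@le_trans _ _ (cmod w * (e / (cmod w + 1) * cmod t))).
      by rewrite ler_wpM2l ?cmod_ge0.
    rewrite mulrA ler_wpM2r ?cmod_ge0// mulrCA ler_piMr ?(ltW e0)//.
    by rewrite ler_pdivrMr// mul1r lerDl.
  have hE := cderiv_comp hA (cderiv_cexp (A 0)).
  have h0 : cderiv (fun z => cexp (A z)) 0 0.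
    move=> e e0; exists 1 => // t _; rewrite !A1 subrr mul0r subr0 cmod0.
    by rewrite mulr_ge0 ?cmod_ge0// ltW.
  have := cderiv_uniq hE h0; rewrite A1 mul1r => /eqP; rewrite subr_eq0 => /eqP.
  move/(congr1 (fun z : C => z^*%C)); rewrite conjcK conjCD conjCM !conjcK => <-.
  by rewrite mulrC.
have pR : p^*%C = p.
  apply: (cderiv_uniq _ hp) => e e0; exists 1 => // t _; rewrite !phiE.
  by rewrite (_ : _ - _ - _ = 0) ?cmod0 ?mulr_ge0 ?cmod_ge0 ?(ltW e0)//; ring.
exists f0, (complex.Re p); split=> // z.
rewrite phiE pR; congr (_ + _ * _).
by case: (p) pR => x y [yy]; apply/eqP; rewrite eq_complex /= eqxx /=; apply/eqP; lra.
Qed.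

(** The image of the disk under phi contains points of modulus arbitrarily
    close to |c| + |a|, so |c| + |a| is at most 1. A slope of modulus at least
    1 leaves only c = 0 and a = 1 or - 1, the identity and an elliptic
    automorphism. *)
Lemma real_slope_lt1 phi c (a : R) : (forall z, phi z = c + a%:C * z) ->
  analytic_self_map phi -> ~ identity_on_disk phi -> ~ elliptic_automorphism phi ->
  `|a| < 1.
Proof.
move=> phiE sm nid nell; rewrite ltNge; apply/negP => a1.
have [_ dd] := sm.
(* The sign of a is absorbed in the point at which phi is evaluated. *)
have dR (t : R) : 0 <= t -> t < 1 -> forall w, cmod w = 1 -> cmod (c + (`|a| * t)%:C * w) < 1.
  move=> t0 t1 w w1.
  have : disk ((Num.sg a * t)%:C * w).
    apply/diskE; rewrite cmodM w1 mulr1 cmodR normrM (ger0_norm t0).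
    by rewrite normr_sg; case: (a == 0); rewrite /= ?mul0r ?mul1r.
  move/dd/diskE; rewrite phiE mulrA -rmorphM /= mulrA.
  by rewrite [`|a|]normrEsg [_ * a]mulrC.
have c1 : cmod c < 1.
  by have := dR 0 (lexx _) ltr01 1 cmod1; rewrite mulr0 mul0r addr0.
(* Evaluate phi on the ray through c, at distance 1 - |c| / 2 from 0. *)
have c0 : c = 0.
  apply/eqP/negPn/negP => c0; have m0 := cmod_gt0 c0.
  have rn : (cmod c)%:C != 0 :> C by rewrite eq_complex /= eqxx andbT lt0r_neq0.
  have w1 : cmod (c / (cmod c)%:C) = 1.
    by rewrite cmodM cmodV cmodR gtr0_norm// mulfV// lt0r_neq0.
  have := dR (1 - cmod c / 2) ltac:(lra) ltac:(lra) _ w1.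
  have -> : c + (`|a| * (1 - cmod c / 2))%:C * (c / (cmod c)%:C) =
     (cmod c + `|a| * (1 - cmod c / 2))%:C * (c / (cmod c)%:C).
    by rewrite rmorphD /= mulrDl; congr (_ + _); rewrite mulrCA mulfV// mulr1.
  rewrite cmodM w1 mulr1 cmodR; apply/negP; rewrite -leNgt.
  apply: le_trans (ler_norm _); nra.
have a1' : `|a| = 1.
  apply/eqP; rewrite eq_le a1 andbT leNgt; apply/negP => a2.
  have a0 : 0 < `|a| by lra.
  have := dR `|a|^-1 ltac:(by rewrite invr_ge0 ltW) ltac:(by rewrite invf_lt1) 1 cmod1.
  by rewrite c0 add0r mulr1 mulfV ?lt0r_neq0// cmod1 ltxx.
have aE : a = 1 \/ a = -1.
  have [h|h] := leP 0 a; first by left; rewrite -(ger0_norm h).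
  by right; rewrite -[a]opprK -(ltr0_norm h) a1'.
case: aE => aE.
  by apply: nid => z _; rewrite phiE c0 add0r aE mul1r.
have phiN z : phi z = - z by rewrite phiE c0 add0r aE rmorphN /= mulN1r.
apply: nell; split=> //; last first.
  exists 0; split; last by rewrite phiN oppr0.
  by apply/diskE; rewrite cmod0.
by split=> //; exists phi; split=> // z _; rewrite !phiN opprK.
Qed.

End SelfAdjointSymbols.

(** * Bounded composition operators have affine symbols *)
Section BoundedComposition.
Context {R : realType}.
Local Notation C := R[i].
Local Notation mu := (@lebesgue_measure R).
Local Notation plane := (measurableTypeR R * measurableTypeR R)%type.
Local Notation mu2 := (mu \x mu)%E.
Implicit Types (h k l psi : C -> C) (z w a b m c t : C).

Definition normsq h : R := complex.Re (fock_inner h h).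

Lemma normsqE h : normsq h = pi^-1 * Rintegral mu2 setT (sqweight h).
Proof.
rewrite /normsq fock_innerE area_integralE /= mul0r subr0; congr (_ * _).
apply: eq_Rintegral => p _.
by rewrite Re_inner_integrand /sqweight cmod_sqr !expr2.
Qed.

Lemma normsq_ge0 h : 0 <= normsq h.
Proof.
rewrite normsqE mulr_ge0 ?invr_ge0 ?pi_ge0//.
by apply: Rintegral_ge0 => p _; exact: sqweight_ge0.
Qed.

Lemma fock_inner_normsq h : fock h -> fock_inner h h = (normsq h)%:C.
Proof.
move=> fh; have := fock_inner_conj fh fh; rewrite /normsq.
by case: (fock_inner h h) => x y [yy]; apply/eqP; rewrite eq_complex /= eqxx; apply/eqP; lra.
Qed.

Lemma fock_norm_sqr h : fock_norm h ^+ 2 = normsq h.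
Proof. by rewrite /fock_norm sqr_sqrtr// normsq_ge0. Qed.

Lemma fock_innerDr a h k l : fock h -> fock k -> fock l ->
  fock_inner l (fun z => a * h z + k z) = a^*%C * fock_inner l h + fock_inner l k.
Proof.
move=> fh fk fl; rewrite (fock_inner_conj (fock_lin a fh fk) fl) (fock_innerDl a fh fk fl).
by rewrite conjCD conjCM (fock_inner_conj fh fl) (fock_inner_conj fk fl).
Qed.

(** Expand the norm of r h - <h, k> k for r > 0 with ||k||^2 at most r.
    Allowing r to exceed ||k||^2 covers the case k = 0. *)
Lemma fock_cauchy_schwarz h k : fock h -> fock k ->
  cmod (fock_inner h k) ^+ 2 <= normsq h * normsq k.
Proof.
move=> fh fk; set m := fock_inner h k.
set n := normsq h; set e := normsq k.
have n0 : 0 <= n := normsq_ge0 h.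
have e0 : 0 <= e := normsq_ge0 k.
have main (r : R) : 0 < r -> e <= r -> cmod m ^+ 2 <= n * r.
  move=> r0 er.
  have frh := fockZ r%:C fh.
  have fy := fock_lin (- m) fk frh.
  have := normsq_ge0 (fun z => - m * k z + r%:C * h z); rewrite /normsq.
  rewrite (fock_innerDl _ fk frh fy) (fock_innerDr _ fk frh fk) (fock_innerDr _ fk frh frh).
  rewrite (fock_innerZr _ fh fk) (fock_innerZl _ fh fk).
  rewrite (fock_innerZl _ fh frh) (fock_innerZr _ fh fh).
  rewrite (fock_inner_conj fh fk) !fock_inner_normsq// -/m -/n -/e conjc_real cmod_sqr.
  case: (m) => x y /=; move: (x) (y) => u v.
  set q := u ^+ 2 + v ^+ 2.
  rewrite [X in 0 <= X](_ : _ = r ^+ 2 * n - 2 * r * q + q * e); last by rewrite /q; ring.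
  have q0 : 0 <= q by rewrite addr_ge0 ?sqr_ge0.
  move=> H; have : r * q <= r * (n * r) by nra.
  by rewrite ler_pM2l.
have [e1|e1] := ltP 0 e; first by apply: main.
have -> : e = 0 by apply/eqP; rewrite eq_le e0 e1.
rewrite mulr0; apply/ler_addgt0Pr => d d0; rewrite add0r.
have n1 : 0 < n + 1 by lra.
apply: (@le_trans _ _ (n * (d / (n + 1)))).
  by apply: main; [rewrite divr_gt0|apply: (le_trans e1); rewrite ltW// divr_gt0].
by rewrite mulrCA ler_piMr ?(ltW d0)// ler_pdivrMr// mul1r lerDl.
Qed.

Lemma kernel_diag w : fock_ker w w = (expR (cmod w ^+ 2))%:C.
Proof. by rewrite /fock_ker mulrC mul_conj_cmod cexpR. Qed.

Lemma normsq_kernel w : normsq (fock_ker w) = expR (cmod w ^+ 2).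
Proof. by rewrite /normsq reproducing ?kernel_diag//; exact: fock_kernel. Qed.

Lemma fock_pointwise h w : fock h -> cmod (h w) ^+ 2 <= normsq h * expR (cmod w ^+ 2).
Proof.
move=> fh; rewrite -normsq_kernel -(reproducing w fh).
exact: fock_cauchy_schwarz (fock_kernel w).
Qed.

(** Apply the pointwise bound at w to the image of the kernel at psi(w), whose
    value there is exp |psi(w)|^2 and whose norm is known. *)
Lemma composition_growth psi : bounded_operator (composition_op psi) ->
  exists2 L : R, 0 <= L & forall w, cmod (psi w) ^+ 2 <= cmod w ^+ 2 + L.
Proof.
move=> [fT _ [M MP]]; exists (M ^+ 2) => [|w]; first exact: sqr_ge0.
have fK := fock_kernel (psi w).
have := fock_pointwise w (fT _ fK).
rewrite {1}/composition_op kernel_diag cmodR (ger0_norm (expR_ge0 _)).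
have : normsq (composition_op psi (fock_ker (psi w))) <= M ^+ 2 * normsq (fock_ker (psi w)).
  rewrite -!fock_norm_sqr -exprMn lerXn2r ?nnegrE ?sqrtr_ge0 ?MP//.
  by apply: le_trans (MP _ fK); rewrite sqrtr_ge0.
rewrite normsq_kernel; set E := expR _; set N := normsq _ => h1 h2.
have E0 : 0 < E by exact: expR_gt0.
have W0 : 0 < expR (cmod w ^+ 2) by exact: expR_gt0.
have h3 : E <= M ^+ 2 * expR (cmod w ^+ 2).
  rewrite -(ler_pM2l E0) -expr2; apply: (le_trans h2).
  by rewrite mulrA [E * _]mulrC ler_pM2r.
rewrite -ler_expR -/E expRD mulrC; apply: (le_trans h3); rewrite ler_pM2r//.
by have := expR_ge1Dx (M ^+ 2); lra.
Qed.

Lemma fock_dominated h (g : plane -> R) : entire h ->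
  mu2.-integrable setT (fun p => (g p)%:E) -> (forall p, sqweight h p <= g p) ->
  fock h /\ normsq h <= pi^-1 * Rintegral mu2 setT g.
Proof.
move=> hh ig hg.
have fh : fock h.
  apply/fockP; split=> //; apply: (le_integrable _ _ _ ig) => //.
    by apply/measurable_EFinP; exact: measurable_sqweight.
  move=> p _; rewrite /= lee_fin ger0_norm ?sqweight_ge0//.
  by apply: (le_trans (hg p)); exact: ler_norm.
split=> //; rewrite normsqE ler_wpM2l ?invr_ge0 ?pi_ge0//.
have [_ ih] := (fockP h).1 fh.
by apply: (le_Rintegral measurableT ih ig) => p _; exact: hg.
Qed.

(** The square of a real number s is at most 4 (e^s + e^(- s)), and the
    exponentials of the coordinates are squared moduli of kernels. *)
Lemma fock_id : fock (id : C -> C).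
Proof.
pose k1 := fock_ker (2^-1)%:C; pose k2 := fock_ker (- 2^-1)%:C.
pose k3 := fock_ker (0 +i* 2^-1); pose k4 := fock_ker (0 +i* - 2^-1).
have I w : mu2.-integrable setT (fun p => (4 * sqweight (fock_ker w) p)%:E).
  by case/fockP: (fock_kernel w) => _ i; exact: (integrableZl measurableT 4 i).
have I12 := integrableD measurableT (I (2^-1)%:C) (I (- 2^-1)%:C).
have I34 := integrableD measurableT (I (0 +i* 2^-1)) (I (0 +i* - 2^-1)).
have [] // := @fock_dominated id _ (@entire_id R) (integrableD measurableT I12 I34).
move=> [x y]; rewrite /sqweight !mulrA -!mulrDl ler_wpM2r ?gauss_ge0//.
rewrite /fock_ker !cmod_cexp cmod_sqr -!mulrA -!expRD /toC /=.
have sq (s : R) : s ^+ 2 <= 4 * expR s + 4 * expR (- s).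
  have main (r : R) : 0 <= r -> r ^+ 2 <= 4 * expR r.
    move=> r0; have h := expR_ge1Dx (r / 2).
    have -> : expR r = expR (r / 2) ^+ 2 by rewrite expr2 -expRD -splitr.
    by rewrite !expr2; nra.
  have [s0|s0] := leP 0 s.
    by apply: (le_trans (main _ s0)); rewrite lerDl mulr_ge0 ?expR_ge0.
  by rewrite -sqrrN; apply: (le_trans (main (- s) ltac:(lra))); rewrite lerDr mulr_ge0 ?expR_ge0.
apply: (le_trans (lerD (sq x) (sq y))); rewrite le_eqVlt; apply/orP; left; apply/eqP.
by congr (_ * expR _ + _ * expR _ + (_ * expR _ + _ * expR _)); field.
Qed.

(** The squared norm of K_(w s) - K_0 - conj w (K_s - K_0), for small s > 0 and
    r = s^2, is of smaller order than r: to first order in r its four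
    exponentials cancel. *)
Lemma kernel_remainder_small w (e : R) : 0 < e ->
  exists2 d : R, 0 < d & forall r : R, 0 < r -> r < d ->
    cmod (cexp (w * w^*%C * r%:C) - 1 - w^*%C * (cexp (w * r%:C) - 1)
          - w * (cexp (w^*%C * r%:C) - 1 - w^*%C * (cexp r%:C - 1)))
    <= 4 * e * cmod w ^+ 2 * r.
Proof.
move=> e0.
have [d d0 dP] := cderiv_cexp 0 e0.
have m0 : 0 < cmod w ^+ 2 + cmod w + 1.
  by have := cmod_ge0 w; have := sqr_ge0 (cmod w); lra.
exists (d / (cmod w ^+ 2 + cmod w + 1)) => [|r r0 rd]; first exact: divr_gt0.
have W0 := cmod_ge0 w; have W2 := sqr_ge0 (cmod w).
rewrite ltr_pdivlMr// in rd.
have X s : cmod s <= (cmod w ^+ 2 + cmod w + 1) * r -> cmod (cexp s - 1 - s) <= e * cmod s.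
  move=> sr; have := dP s ltac:(by apply: (le_lt_trans sr); rewrite mulrC).
  by rewrite add0r cexp0 mul1r.
have rE : cmod r%:C = r by rewrite cmodR gtr0_norm.
have c1 : cmod (w * w^*%C * r%:C) = cmod w ^+ 2 * r by rewrite !cmodM cmodJ rE expr2.
have c2 : cmod (w * r%:C) = cmod w * r by rewrite cmodM rE.
have c3 : cmod (w^*%C * r%:C) = cmod w * r by rewrite cmodM cmodJ rE.
have X1 := X (w * w^*%C * r%:C) ltac:(by rewrite c1 ler_pM2r//; lra).
have X2 := X (w * r%:C) ltac:(by rewrite c2 ler_pM2r//; lra).
have X3 := X (w^*%C * r%:C) ltac:(by rewrite c3 ler_pM2r//; lra).
have X4 := X r%:C ltac:(by rewrite rE ler_peMl ?(ltW r0)//; lra).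
rewrite c1 in X1; rewrite c2 in X2; rewrite c3 in X3; rewrite rE in X4.
set Y1 := _ - _ - _ in X1; set Y2 := _ - _ - _ in X2.
set Y3 := _ - _ - _ in X3; set Y4 := _ - _ - _ in X4.
rewrite (_ : _ - _ = Y1 - w^*%C * Y2 - w * Y3 + w * w^*%C * Y4); last first.
  by rewrite /Y1 /Y2 /Y3 /Y4; ring.
apply: (le_trans (cmodD _ _)).
have b1 := cmodB (Y1 - w^*%C * Y2) (w * Y3).
have b2 := cmodB Y1 (w^*%C * Y2).
move: b1 b2; rewrite !cmodM !cmodJ => b1 b2.
have := ler_wpM2l W0 X2; have := ler_wpM2l W0 X3; have := ler_wpM2l W2 X4.
rewrite !expr2; lra.
Qed.

(** The functions psi(r z) have norms of order r, since psi grows at most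
    linearly. Pairing psi(r z) with K_(w / r) - K_0 - conj w (K_(1 / r) - K_0)
    gives psi(w) - psi(0) - w (psi(1) - psi(0)), which does not depend on r,
    while the norm of the second function is of smaller order than 1 / r. Let r
    tend to infinity. *)
Lemma bounded_composition_affine psi : entire psi ->
  bounded_operator (composition_op psi) ->
  forall w, psi w = psi 0 + (psi 1 - psi 0) * w.
Proof.
move=> hpsi bC w.
have [L L0 LP] := composition_growth bC.
set D := psi w - psi 0 - w * (psi 1 - psi 0).
suff : D = 0 by rewrite /D => /eqP; rewrite subr_eq0 subr_eq => /eqP ->; ring.
pose Q := normsq id + L.
have Q0 : 0 <= Q by rewrite addr_ge0 ?normsq_ge0.
have main (r : R) : 1 <= r ->
   cmod D ^+ 2 <= r ^+ 2 * Q * cmod (cexp (w * w^*%C * (r^-1 ^+ 2)%:C) - 1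
      - w^*%C * (cexp (w * (r^-1 ^+ 2)%:C) - 1)
      - w * (cexp (w^*%C * (r^-1 ^+ 2)%:C) - 1 - w^*%C * (cexp (r^-1 ^+ 2)%:C - 1))).
  move=> r1; have r0 : 0 < r by lra.
  pose F z := psi (r%:C * z).
  have hF : entire F by exact: (@entire_dilate R r%:C psi hpsi).
  have [_ iid] := (fockP (@id C)).1 fock_id; have [_ i1] := (fockP (@const1 R)).1 (@fock_const1 R).
  have Ig := integrableD measurableT (integrableZl measurableT (r ^+ 2) iid)
    (integrableZl measurableT L i1).
  have [|fF NF] := @fock_dominated F (fun p => r ^+ 2 * sqweight id p + L * sqweight const1 p) hF Ig.
    move=> p; rewrite /sqweight cmod1.
    have -> : r ^+ 2 * (cmod (id (toC p)) ^+ 2 * gauss (toC p)) +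
        L * (1 ^+ 2 * gauss (toC p)) =
      (r ^+ 2 * cmod (toC p) ^+ 2 + L) * gauss (toC p) by ring.
    rewrite ler_wpM2r ?gauss_ge0//.
    by apply: (le_trans (LP _)); rewrite cmodM cmodR gtr0_norm// exprMn.
  have {}NF : normsq F <= r ^+ 2 * Q.
    apply: (le_trans NF).
    rewrite (RintegralD measurableT (integrableZl measurableT (r ^+ 2) iid)
      (integrableZl measurableT L i1)) !RintegralZl//.
    have N1 : normsq (@const1 R) = 1 by rewrite /normsq fock_inner_const1.
    rewrite (_ : pi^-1 * _ = r ^+ 2 * normsq id + L * normsq (@const1 R)); last first.
      by rewrite !normsqE; ring.
    have h : L <= r ^+ 2 * L by rewrite ler_peMl// expr2; nra.
    by rewrite N1 /Q; lra.
  have v0 : (r^-1)%:C * r%:C = 1 :> C.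
    by rewrite -rmorphM /= mulVf ?lt0r_neq0.
  pose u : C := (r^-1)%:C.
  have uJ : u^*%C = u by exact: conjc_real.
  pose k0 := fock_ker (0 : C).
  have f0 : fock k0 by exact: fock_kernel.
  pose E1 z := - 1 * k0 z + fock_ker u z.
  have fE1 : fock E1 by exact: fock_lin (fock_kernel _).
  pose E2 z := - 1 * k0 z + fock_ker (w * u) z.
  have fE2 : fock E2 by exact: fock_lin (fock_kernel _).
  pose E z := - w^*%C * E1 z + E2 z.
  have fE : fock E by exact: fock_lin.
  have innE h : fock h -> fock_inner h E = h (w * u) - h 0 - w * (h u - h 0).
    move=> fh; rewrite (fock_innerDr _ fE1 fE2 fh).
    rewrite (fock_innerDr _ f0 (fock_kernel _) fh) (fock_innerDr _ f0 (fock_kernel _) fh).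
    rewrite !reproducing//.
    have -> : (- w^*%C)^*%C = - w by rewrite -{2}[w]conjcK; exact: rmorphN.
    have -> : (- 1 : C)^*%C = - 1 by rewrite -{2}[1]conjc1; exact: rmorphN.
    by ring.
  have := fock_cauchy_schwarz fF fE; rewrite (innE _ fF).
  have -> : F (w * u) - F 0 - w * (F u - F 0) = D.
    have ru : r%:C * u = 1 by rewrite mulrC.
    by rewrite /F /D mulr0 ru mulrCA ru mulr1.
  move/le_trans; apply; apply: ler_pM => //; rewrite ?normsq_ge0//.
  rewrite /normsq (innE _ fE); apply: le_trans (ler_norm _) _.
  apply: le_trans (cmod_Re _) _; rewrite le_eqVlt; apply/orP; left; apply/eqP; congr cmod.
  rewrite /E /E1 /E2 /k0 /fock_ker conjc0 !mul0r !mulr0 cexp0 conjCM uJ.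
  have -> : (r^-1 ^+ 2)%:C = u * u by rewrite rmorphXn /= expr2.
  rewrite (_ : w^*%C * u * (w * u) = w * w^*%C * (u * u)); last by ring.
  rewrite (_ : u * (w * u) = w * (u * u)); last by ring.
  rewrite (_ : w^*%C * u * u = w^*%C * (u * u)); last by ring.
  by ring.
apply: cmod_eq0; apply/eqP; rewrite -sqrf_eq0 -[_ == 0]andbT.
rewrite eq_le sqr_ge0 !andbT; apply/ler_addgt0Pr => e e0; rewrite add0r.
have W2 := sqr_ge0 (cmod w).
have m0 : 0 < 4 * Q * cmod w ^+ 2 + 1.
  by apply: ltr_wpDl => //; apply: mulr_ge0 => //; apply: mulr_ge0.
have [d d0 dP] := kernel_remainder_small w (divr_gt0 e0 m0).
(* This r satisfies r >= 1 and r^-2 <= r^-1 < d. *)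
pose r := 1 + d^-1.
have d10 : 0 < d^-1 by rewrite invr_gt0.
have r1 : 1 <= r by rewrite lerDl ltW.
have r0 : 0 < r by lra.
have rd : r^-1 ^+ 2 < d.
  apply: (@le_lt_trans _ _ r^-1).
    by rewrite expr2 ler_piMr ?invr_ge0 ?(ltW r0)// invf_le1.
  by rewrite -[d]invrK ltf_pV2 ?posrE// /r ltrDr.
have rn : 0 < r^-1 ^+ 2 by rewrite exprn_gt0// invr_gt0.
apply: (le_trans (main r r1)).
apply: (@le_trans _ _ (r ^+ 2 * Q * (4 * (e / (4 * Q * cmod w ^+ 2 + 1)) * cmod w ^+ 2 * r^-1 ^+ 2))).
  by apply: ler_wpM2l; [rewrite mulr_ge0// sqr_ge0|exact: dP].
have -> : r ^+ 2 * Q * (4 * (e / (4 * Q * cmod w ^+ 2 + 1)) * cmod w ^+ 2 * r^-1 ^+ 2) =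
    e * (4 * Q * cmod w ^+ 2 / (4 * Q * cmod w ^+ 2 + 1)).
  by field; rewrite !lt0r_neq0.
by rewrite ler_piMr ?(ltW e0)// ler_pdivrMr// mul1r lerDl.
Qed.

End BoundedComposition.

(** * The symbols of an operator in the commutant *)
Section Commutant.
Context {R : realType}.
Local Notation C := R[i].
Implicit Types (h k f g phi psi q : C -> C) (z w b c d : C).

Lemma cexp_mul_eq1 z : (forall w, cexp (w * z) = 1) -> z = 0.
Proof.
move=> h; apply/eqP/negPn/negP => z0.
have := h z^-1; rewrite mulVf// => /(congr1 (@cmod R)); rewrite cmod_cexp cmod1 /=.
by have := @expR_gt1 R 1; rewrite ltr01 => /[swap] ->; rewrite ltxx.
Qed.

(** Iterating the contraction brings every point to b. *)
Lemma invariant_under_contraction q b (a : R) : entire q -> `|a| < 1 ->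
  (forall z, q (b + a%:C * (z - b)) = q z) -> forall z, q z = q b.
Proof.
move=> hq a1 inv z.
have iter n : q (b + (a ^+ n)%:C * (z - b)) = q z.
  elim: n => [|n <-]; first by rewrite expr0 mul1r addrC subrK.
  rewrite -(inv (b + (a ^+ n)%:C * (z - b))); congr q.
  by rewrite [b + _ - b]addrC addKr mulrA -rmorphM /= exprS.
apply/eqP; rewrite -subr_eq0; apply/eqP/cmod_eq0/eqP.
rewrite eq_le cmod_ge0 andbT; apply/ler_addgt0Pr => e e0; rewrite add0r.
have [l hl] := entire_cderiv b hq.
have [d d0 dP] := cderiv_cont hl e0.
have m0 : 0 < cmod (z - b) + 1 by rewrite ltr_wpDl// cmod_ge0.
have /cvgrPdist_lt/(_ _ (divr_gt0 d0 m0)) := cvg_expr a1.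
move=> [N _ /(_ N (leqnn N))]; rewrite sub0r normrN ltr_pdivlMr// => aN.
rewrite -(iter N); apply/ltW/dP; rewrite cmodM cmodR.
by apply: le_lt_trans aN; rewrite ler_wpM2l// lerDl.
Qed.

(** Evaluated at b on kernels, the commutation relation shows that psi(b) is a
    fixed point of phi, hence psi(b) = b. Evaluated on the constant 1 it gives
    f (g o phi) = g (f o psi); dividing g by the exponential of the conclusion
    turns this into invariance under the contraction phi, so the quotient is
    constant. *)
Lemma commuting_symbols f phi g psi b (f0 : C) (a : R) : f0 != 0 ->
  (forall z, f z = f0 * cexp ((phi 0)^*%C * z)) ->
  (forall z, phi z = phi 0 + a%:C * z) -> `|a| < 1 -> phi b = b ->
  entire g -> g b != 0 ->
  (forall w, psi w = psi 0 + (psi 1 - psi 0) * w) ->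
  commute_on_fock (weighted_composition_op f phi) (weighted_composition_op g psi) ->
  exists d, (forall z, psi z = b + d * (z - b)) /\
    (forall z, g z = g b * cexp (b^*%C * (1 - d) * (z - b))).
Proof.
move=> f00 fE phiE a1 phib hg gb psiE comm.
have fn0 z : f z != 0 by rewrite fE mulf_neq0// cexp_neq0.
have cE : phi 0 = b - a%:C * b by apply/eqP; rewrite eq_sym subr_eq -phiE phib.
have phibE z : phi z = b + a%:C * (z - b) by rewrite phiE cE; ring.
have rel z : f z * g (phi z) = g z * f (psi z).
  by have := comm _ fock_const1 z; rewrite /weighted_composition_op /const1 !mulr1.
have an1 : 1 - a%:C != 0 :> C.
  rewrite subr_eq0; apply/eqP => /(congr1 (@cmod R)); rewrite cmod1 cmodR => E.
  by move: a1; rewrite -E ltxx.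
have psib : psi b = b.
  have E : psi b - phi (psi b) = 0.
    apply: cexp_mul_eq1 => w.
    have := comm _ (fock_kernel w^*%C) b.
    rewrite /weighted_composition_op /fock_ker conjcK phib !mulrA.
    have -> : f b * g b = g b * f (psi b) by rewrite -rel phib.
    move/(mulfI (mulf_neq0 gb (fn0 _))) => E.
    by rewrite mulrBr cexpB E mulfV// cexp_neq0.
  have : (1 - a%:C) * (psi b - b) = 0 by rewrite -E phibE; ring.
  by move/eqP; rewrite mulf_eq0 (negbTE an1) subr_eq0 => /eqP.
pose d := psi 1 - psi 0; exists d.
have psibE z : psi z = b + d * (z - b).
  rewrite -{1}psib psiE [psi b]psiE -/d; ring.
split=> // z.
pose q z := g z * cexp (- (b^*%C * (1 - d)) * z).
have hq : entire q.
  exact: (entireM hg (entire_comp (@entire_cexp R) (@entireZ R (- (b^*%C * (1 - d))) id (@entire_id R)))).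
have cJ : (phi 0)^*%C = (1 - a%:C) * b^*%C.
  rewrite cE; have -> : b - a%:C * b = (1 - a%:C) * b by ring.
  rewrite conjCM; congr (_ * _).
  by apply/eqP; rewrite eq_complex /= eqxx subr0 oppr0 eqxx.
have inv z' : q (b + a%:C * (z' - b)) = q z'.
  have := rel z'; rewrite !fE -phibE -!mulrA [g z' * _]mulrCA => /(mulfI f00) E.
  rewrite /q.
  have -> : g (phi z') = g z' * cexp ((phi 0)^*%C * psi z' - (phi 0)^*%C * z').
    by rewrite cexpB mulrA -E mulrAC mulfV ?mul1r// cexp_neq0.
  rewrite -mulrA -cexpD cJ psibE phibE; congr (_ * cexp _); ring.
have := invariant_under_contraction hq a1 inv z; rewrite /q.
move: (b^*%C * (1 - d)) => s.
move/(congr1 (fun x => x * cexp (s * z))).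
rewrite -!mulrA -!cexpD !mulNr addNr cexp0 mulr1 => ->.
by congr (_ * cexp _); ring.
Qed.

Lemma weighted_composition_weyl_dilation g psi b d :
  (forall z, psi z = b + d * (z - b)) ->
  (forall z, g z = g b * cexp (b^*%C * (1 - d) * (z - b))) ->
  weighted_composition_op g psi = weyl_dilation b (g b) d.
Proof.
move=> psiE gE; apply/funext => h; apply/funext => z.
rewrite /weighted_composition_op /weyl_dilation /weyl /dilate.
rewrite [in LHS]gE psiE [- b + z]addrC.
have -> : (- b)^*%C = - b^*%C by exact: rmorphN.
rewrite cmodN; set x := (cmod b ^+ 2 / 2)%:C.
have xE : x + x = b * b^*%C by rewrite /x -rmorphD /= -splitr mul_conj_cmod.
have -> : cexp (b^*%C * (1 - d) * (z - b)) =
    cexp (- (b^*%C * (d * (z - b))) - x) * cexp (- (- b^*%C * z) - x).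
  rewrite -cexpD; congr cexp.
  transitivity (- (b^*%C * (d * (z - b))) + b^*%C * z - (x + x)); last by ring.
  by rewrite xE; ring.
by move: (cexp _) (cexp _) (h _) => E1 E2 y; ring.
Qed.

End Commutant.

Theorem proposition3p10 (R : realType) (f phi g psi : R[i] -> R[i]) (b : R[i])
  (f_entire : entire f) (phi_entire : entire phi)
  (g_entire : entire g) (psi_entire : entire psi)
  (g_Hinfty : Hinfty g)
  (g_neq0 : forall z, disk z -> g z <> 0)
  (psi_self_map : analytic_self_map psi)
  (f_Hinfty : Hinfty f)
  (f_nontrivial : exists z, f z <> 0)
  (phi_self_map : analytic_self_map phi)
  (W_self_adjoint : self_adjoint (weighted_composition_op f phi))
  (W_commutant :
     commutant (weighted_composition_op f phi) (weighted_composition_op g psi))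
  (phi_not_id : ~ identity_on_disk phi)
  (phi_not_elliptic : ~ elliptic_automorphism phi)
  (b_disk : disk b) (phi_b : phi b = b)
  (C_psi_bounded : bounded_operator (composition_op psi)) :
  normal_operator (weighted_composition_op g psi).
Proof.
have [bS comm] := W_commutant.
have [f0 [a [f00 fE phiE]]] := selfadjoint_symbols phi_entire f_nontrivial W_self_adjoint.
have a1 := real_slope_lt1 phiE phi_self_map phi_not_id phi_not_elliptic.
have gb : g b != 0 by apply/eqP; exact: g_neq0.
have psiE := bounded_composition_affine psi_entire C_psi_bounded.
have [d [psibE gE]] := commuting_symbols f00 fE phiE a1 phi_b g_entire gb psiE comm.
have E := weighted_composition_weyl_dilation psibE gE.
by rewrite E in bS *; exact: weyl_dilation_normal.
Qed.
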